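(* Let $M$ be a 2-dimensional Riemannian manifold of Gaussian curvature $K$, and let $\xi$ be a smooth unit vector field on $M$. Let $e_0,e_1,\eta$ be smooth unit vector fields on $M$ such that $\nabla_{e_0}\xi=0$ and $(\xi,\eta)$, $(e_0,e_1)$ are orthonormal frames, and let $\lambda,\mu,\sigma$ be the functions defined by $\nabla_{e_1}\xi=\lambda\eta$, $\nabla_{e_0}e_0=\mu e_1$, $\nabla_{e_1}e_1=\sigma e_0$. Put $s=1$ if the frames $(\xi,\eta)$ and $(e_0,e_1)$ have the same orientation and $s=0$ otherwise. Then the second fundamental form $\Omega$ of the submanifold $\xi(M)\subset T_1M$ (with respect to the orthonormal tangent frame $\tilde e_0,\tilde e_1$ and the unit normal $\tilde n$ given in the context) can be presented in the two equivalent forms: (i) $$ \Omega=\begin{pmatrix} -\mu\,\dfrac{\lambda}{\sqrt{1+\lambda^2}} & (-1)^{s+1}\dfrac{K}{2}+\dfrac{e_0(\lambda)}{1+\lambda^2}\\[2ex] (-1)^{s+1}\dfrac{K}{2}+\dfrac{e_0(\lambda)}{1+\lambda^2} & e_1\!\left(\dfrac{\lambda}{\sqrt{1+\lambda^2}}\right) \end{pmatrix}, $$ (ii) $$ \Omega=\begin{pmatrix} -\mu\,\dfrac{\lambda}{\sqrt{1+\lambda^2}} & \dfrac12\left(\sigma\lambda+\dfrac{1-\lambda^2}{1+\lambda^2}\,e_0(\lambda)\right)\\[2ex] \dfrac12\left(\sigma\lambda+\dfrac{1-\lambda^2}{1+\lambda^2}\,e_0(\lambda)\right) & e_1\!\left(\dfrac{\lambda}{\sqrt{1+\lambda^2}}\right)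 \end{pmatrix}. $$
   Context: For a Riemannian manifold $(M,g)$ with Levi-Civita connection $\nabla$, each tangent vector $\tilde X$ to $TM$ at $(p,\zeta)$ decomposes uniquely as $\tilde X=X_1^h+X_2^v$ with $X_1,X_2\in T_pM$, where $(\cdot)^h$ and $(\cdot)^v$ are the horizontal (with respect to $\nabla$) and vertical lifts. The Sasaki metric on $TM$ is $\langle\langle \tilde X,\tilde Y\rangle\rangle=\langle X_1,Y_1\rangle+\langle X_2,Y_2\rangle$. The unit tangent bundle $T_1M\subset TM$ carries the induced metric. A unit vector field $\xi$ is viewed as a map $\xi:M\to T_1M$, and $\xi(M)$ carries the metric induced from $T_1M$. At each point $(p,\xi)\in\xi(M)$ the vectors $\tilde e_0=e_0^h$, $\tilde e_1=\frac{1}{\sqrt{1+\lambda^2}}(e_1^h+\lambda\eta^v)$ form an orthonormal frame tangent to $\xi(M)$, and $\tilde n=\frac{1}{\sqrt{1+\lambda^2}}(-\lambda e_1^h+\eta^v)$ is a unit normal of $\xi(M)$ in $T_1M$. The second fundamental form is $\Omega_{ij}=\langle\langle\tilde\nabla_{\tilde e_i}\tilde e_j,\tilde n\rangle\rangle$, $i,j\in\{0,1\}$, where $\tilde\nabla$ is the Levi-Civita connection of the Sasaki metric. $X(\phi)$ denotes the derivative of a function $\phi$ along a vector field $X$. *)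

(* Defs.v *)
From HB Require Import structures.
From mathcomp Require Import all_boot all_order all_algebra.
From mathcomp Require Import all_classical all_reals all_analysis.
Set Implicit Arguments.
Unset Strict Implicit.
Unset Printing Implicit Defensive.
Import Order.TTheory GRing.Theory Num.Theory.
Import numFieldNormedType.Exports.
Local Open Scope classical_set_scope.
Local Open Scope ring_scope.

(* In finite dimension, asking for directional derivatives in every direction,
   rather than for partial derivatives, gives the usual classes C^k(U). *)
Fixpoint Ck (R : realType) (V W : normedModType R) (U : set V) (k : nat)
    (f : V -> W) : Prop :=
  (forall x, U x -> {for x, continuous f}) /\
  match k with
  | 0%N => True
  | k'.+1 => forall v : V,
      (forall x, U x -> derivable f x v) /\ Ck U k' (fun x => 'D_v f x)
  end.

Definition smooth_on (R : realType) (V W : normedModType R) (U : set V)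
    (f : V -> W) : Prop :=
  forall k, Ck U k f.

(* Riemannian geometry in a coordinate domain of R^n.  Points and tangent
   vectors are row vectors, a metric is a matrix-valued function. *)
Section Coordinates.
Context {R : realType} {n : nat}.
Implicit Types (g : 'rV[R]_n -> 'M[R]_n) (x u v w : 'rV[R]_n).
Implicit Types (Y : 'rV[R]_n -> 'rV[R]_n).

Definition inner g x u v : R := (u *m g x *m v^T) 0 0.

Definition basis_vec (i : 'I_n) : 'rV[R]_n := delta_mx 0 i.

Definition partial (i : 'I_n) (f : 'rV[R]_n -> R) x : R := 'D_(basis_vec i) f x.

(* The Christoffel symbol Gamma^k_{ij} of the Levi-Civita connection. *)
Definition christoffel g x (i j k : 'I_n) : R :=
  2^-1 * \sum_l invmx (g x) k l *
    (partial i (fun y => g y j l) x + partial j (fun y => g y i l) x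
     - partial l (fun y => g y i j) x).

Definition gamma g x u v : 'rV[R]_n :=
  \row_k \sum_i \sum_j u 0 i * v 0 j * christoffel g x i j k.

(* The Levi-Civita covariant derivative of the field Y in the direction u. *)
Definition cov g u Y x : 'rV[R]_n := 'D_u Y x + gamma g x u (Y x).

(* R(u,v)w = nabla_u nabla_v w - nabla_v nabla_u w for fields u, v, w with
   constant components, for which [u,v] = 0. *)
Definition curv g x u v w : 'rV[R]_n :=
  cov g u (fun y => cov g v (fun=> w) y) x
  - cov g v (fun y => cov g u (fun=> w) y) x.

(* Points of TM, and vectors tangent to TM, have coordinates
   (base part, fibre part) in R^(n + n): these are the charts of TM
   induced by those of M. *)

Definition vlift (v : 'rV[R]_n) : 'rV[R]_(n + n) := row_mx 0 v.

Definition hlift g (z : 'rV[R]_(n + n)) v : 'rV[R]_(n + n) :=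
  row_mx v (- gamma g (lsubmx z) v (rsubmx z)).

(* The components U1, U2 of U = U1^h + U2^v. *)
Definition hpart (U : 'rV[R]_(n + n)) : 'rV[R]_n := lsubmx U.

Definition vpart g (z U : 'rV[R]_(n + n)) : 'rV[R]_n :=
  rsubmx U + gamma g (lsubmx z) (lsubmx U) (rsubmx z).

Lemma hv_decomp g (z U : 'rV[R]_(n + n)) :
  U = hlift g z (hpart U) + vlift (vpart g z U).
Proof.
by rewrite /hlift /vlift /hpart /vpart add_row_mx addr0 addrCA addNr addr0
  hsubmxK.
Qed.

Definition sasaki_form g (z U V : 'rV[R]_(n + n)) : R :=
  inner g (lsubmx z) (hpart U) (hpart V)
  + inner g (lsubmx z) (vpart g z U) (vpart g z V).

Definition sasaki g (z : 'rV[R]_(n + n)) : 'M[R]_(n + n) :=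
  \matrix_(a, b) sasaki_form g z (delta_mx 0 a) (delta_mx 0 b).

(* A vector field, seen as a map into TM. *)
Definition section (xi : 'rV[R]_n -> 'rV[R]_n) x : 'rV[R]_(n + n) :=
  row_mx x (xi x).

End Coordinates.

(* The covariant derivative, in the direction u, of a vector field Y along a
   map f into a coordinate domain with metric g: it is nabla_{df(u)} Y', for
   any local extension Y' of Y. *)
Definition cov_along (R : realType) (n m : nat) (g : 'rV[R]_m -> 'M[R]_m)
    (f : 'rV[R]_n -> 'rV[R]_m) (u : 'rV[R]_n) (Y : 'rV[R]_n -> 'rV[R]_m)
    (x : 'rV[R]_n) : 'rV[R]_m :=
  'D_u Y x + gamma g (f x) ('D_u f x) (Y x).

Definition gauss_curv (R : realType) (g : 'rV[R]_2 -> 'M[R]_2) (x : 'rV[R]_2)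
    : R :=
  let a := basis_vec 0 in let b := basis_vec 1 in
  inner g x (curv g x a b b) a
  / (inner g x a a * inner g x b b - inner g x a b ^+ 2).

Section UnitFieldSubmanifold.
Context {R : realType}.
Variables (g : 'rV[R]_2 -> 'M[R]_2) (xi eta e0 e1 : 'rV[R]_2 -> 'rV[R]_2).
Variable lambda : 'rV[R]_2 -> R.

Definition etilde (i : 'I_2) (x : 'rV[R]_2) : 'rV[R]_(2 + 2) :=
  if i == 0 then hlift g (section xi x) (e0 x)
  else (Num.sqrt (1 + lambda x ^+ 2))^-1 *:
    (hlift g (section xi x) (e1 x) + lambda x *: vlift (eta x)).

Definition ntilde (x : 'rV[R]_2) : 'rV[R]_(2 + 2) :=
  (Num.sqrt (1 + lambda x ^+ 2))^-1 *:
    (- lambda x *: hlift g (section xi x) (e1 x) + vlift (eta x)).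

(* Omega_ij = <<nabla~_{e~_i} e~_j, n~>>.  The fields e~_j live along the map
   xi.  Since d(xi)(X) = X^h + (nabla_X xi)^v, the tangent vector e~_i is the
   image under d(xi) of its projection hpart e~_i, so nabla~_{e~_i} e~_j is the
   covariant derivative along xi in the direction hpart e~_i. *)
Definition second_fundamental_form (x : 'rV[R]_2) : 'M[R]_2 :=
  \matrix_(i, j) inner (sasaki g) (section xi x)
    (cov_along (sasaki g) (section xi) (hpart (etilde i x)) (etilde j) x)
    (ntilde x).

End UnitFieldSubmanifold.

(* [chart i] is only meaningful on [dom i], and [chart_inv i] on the image of
   [dom i]. *)
Record smooth_manifold (R : realType) (n : nat) := SmoothManifold {
  msort :> topologicalType;
  mhausdorff : hausdorff_space msort;
  msecond_countable : @second_countable msort;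
  chart_index : Type;
  dom : chart_index -> set msort;
  chart : chart_index -> msort -> 'rV[R]_n;
  chart_inv : chart_index -> 'rV[R]_n -> msort;
  dom_open : forall i, open (dom i);
  dom_cover : forall p, exists i, dom i p;
  chart_open : forall i, open (chart i @` dom i);
  chartK : forall i p, dom i p -> chart_inv i (chart i p) = p;
  chart_continuous : forall i p, dom i p -> {for p, continuous (chart i)};
  chart_inv_continuous : forall i x, (chart i @` dom i) x ->
    {for x, continuous (chart_inv i)};
  transition_smooth : forall i j,
    smooth_on (chart i @` (dom i `&` dom j)) (chart j \o chart_inv i)
}.

(* Smooth vector fields and Riemannian metrics, given by their components in
   each chart and the transformation law under the transition maps. *)
Record vector_field (R : realType) (n : nat) (M : smooth_manifold R n) :=
  VectorField {
  vf :> chart_index M -> 'rV[R]_n -> 'rV[R]_n;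
  vf_smooth : forall i, smooth_on (chart i @` dom i) (vf i);
  vf_compat : forall i j p, dom i p -> dom j p ->
    vf j (chart j p)
    = 'D_(vf i (chart i p)) (chart j \o chart_inv i) (chart i p)
}.

Record riemannian_metric (R : realType) (n : nat) (M : smooth_manifold R n) :=
  RiemannianMetric {
  rm :> chart_index M -> 'rV[R]_n -> 'M[R]_n;
  rm_smooth : forall i, smooth_on (chart i @` dom i) (rm i);
  rm_sym : forall i p, dom i p -> (rm i (chart i p))^T = rm i (chart i p);
  rm_pos : forall i p, dom i p -> forall v : 'rV[R]_n, v != 0 ->
    0 < inner (rm i) (chart i p) v v;
  rm_compat : forall i j p, dom i p -> dom j p -> forall u v : 'rV[R]_n,
    inner (rm i) (chart i p) u v
    = inner (rm j) (chart j p)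
        ('D_u (chart j \o chart_inv i) (chart i p))
        ('D_v (chart j \o chart_inv i) (chart i p))
}.

Section OnManifold.
Context {R : realType} {n : nat} {M : smooth_manifold R n}.
Implicit Types (g : riemannian_metric M) (X Y : vector_field M).
Implicit Types (i : chart_index M) (p : M).

Definition vf_at X i p : 'rV[R]_n := X i (chart i p).

Definition inner_at g X Y i p : R :=
  inner (g i) (chart i p) (vf_at X i p) (vf_at Y i p).

Definition nabla g X Y i p : 'rV[R]_n :=
  cov (g i) (vf_at X i p) (Y i) (chart i p).

Definition vderive X (phi : M -> R) i p : R :=
  'D_(vf_at X i p) (phi \o chart_inv i) (chart i p).

Definition orthonormal_pair g X Y : Prop :=
  forall i p, dom i p ->
    [/\ inner_at g X X i p = 1, inner_at g Y Y i p = 1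
      & inner_at g X Y i p = 0].

End OnManifold.

(* Two frames have the same orientation when the matrix of one with respect to
   the other has positive determinant; this does not depend on the chart. *)
Definition same_orientation (R : realType) (M : smooth_manifold R 2)
    (X Y X' Y' : vector_field M) (i : chart_index M) (p : M) : bool :=
  0 < \det (col_mx (vf_at X i p) (vf_at Y i p)
            *m invmx (col_mx (vf_at X' i p) (vf_at Y' i p)) : 'M[R]_2).

Definition mx2 (R : realType) (a b c d : R) : 'M[R]_2 :=
  \matrix_(i < 2, j < 2)
    if i == 0 then (if j == 0 then a else b) else (if j == 0 then c else d).

(* Main.v *)
Require Import Defs.
From HB Require Import structures.
From mathcomp Require Import all_boot all_order all_algebra.
From mathcomp Require Import all_classical all_reals all_analysis.
From mathcomp Require Import perm ring lra.
Set Implicit Arguments.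
Unset Strict Implicit.
Unset Printing Implicit Defensive.
Import Order.TTheory GRing.Theory Num.Theory.
Import numFieldNormedType.Exports.
Local Open Scope classical_set_scope.
Local Open Scope ring_scope.

(** The proof is a computation in one chart, with the Levi-Civita connection of
    the Sasaki metric reduced to the connection and the curvature of the base.

    For fields $Y = Y_1^h + Y_2^v$ along the section $\xi$ and vectors
    $W = W_1^h + W_2^v$ the Koszul formula gives ([cov_along_hvlift])
    $$ \langle\langle\tilde\nabla_u Y, W\rangle\rangle
       = \langle\nabla_u Y_1, W_1\rangle + \langle\nabla_u Y_2, W_2\rangle
       + \tfrac12\bigl(-\langle R(u,Y_1)\xi, W_2\rangle
           + \langle R(u,W_1)\xi, Y_2\rangle
           + \langle R(Y_1,W_1)\xi, \nabla_u\xi\rangle\bigr). $$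
    The curvature appears because the vertical part of a coordinate field
    depends on the base point through the Christoffel symbols, and exchanging
    two covariant derivatives of these costs a curvature term
    ([vpart_cov_comm], [gamma_sasaki]).

    On a surface the only curvature in this formula is $R(e_0,e_1)\xi$. Since
    $\nabla\xi = \omega\otimes\eta$ and $\nabla\eta = -\omega\otimes\xi$
    for $\omega = \lambda\langle\cdot, e_1\rangle$, it equals
    $d\omega(e_0,e_1)\,\eta$ with
    $d\omega(e_0,e_1) = e_0(\lambda) - \sigma\lambda$ ([curv_rotation],
    [connection_form_d]). Inserting $\tilde e_0 = e_0^h$ and the frame
    $(\tilde e_1, \tilde n)$, which is $(e_1^h, \eta^v)$ rotated by the angle
    $\arctan\lambda$, gives the second form of the matrix
    ([second_fundamental_formE]). The operator $R(e_0,e_1)$ is an infinitesimal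
    rotation, so that $d\omega(e_0,e_1)$ is also $-(-1)^{s+1}K$
    ([gauss_curv_frames]); eliminating $\sigma\lambda$ gives the first form.

    The analytic input consists of two consequences of the mean value theorem:
    maps with continuous directional derivatives are differentiable
    ([C1_differentiable]), and second derivatives commute ([derive_comm]). *)

(** * Directional derivatives and differentiability *)

Lemma is_derive_line (R : realType) (V W : normedModType R) (f : V -> W)
    (a v : V) (s : R) (df : W) :
  is_derive (a + s *: v) v f df ->
  is_derive s (1 : R) (fun h => f (a + h *: v)) df.
Proof.
case=> fav fdf.
have E : (fun h : R => h^-1 *: (((fun k : R => f (a + k *: v)) \o shift s)
      (h *: (1 : R)) - f (a + s *: v)))
    = (fun h : R => h^-1 *: ((f \o shift (a + s *: v)) (h *: v)
      - f (a + s *: v))).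
  apply/funext => h /=; congr (_ *: (f _ - _)).
  by rewrite [h *: 1]mulr1 scalerDl addrCA.
by split; [rewrite /derivable E | rewrite -fdf /derive E].
Qed.

Lemma mean_value_line (R : realType) (V : normedModType R) (f : V -> R)
    (a v : V) (t : R) :
  (forall s, `|s| <= `|t| -> derivable f (a + s *: v) v) ->
  exists2 s, `|s| <= `|t| &
    f (a + t *: v) - f a = t * 'D_v f (a + s *: v).
Proof.
move=> fd.
have der s : `|s| <= `|t| ->
    is_derive s (1 : R) (fun h => f (a + h *: v)) ('D_v f (a + s *: v)).
  by move=> st; apply/is_derive_line/derivableP/fd.
have cts b c : (forall s, s \in `[b, c] -> `|s| <= `|t|) ->
    {within `[b, c], continuous (fun h => f (a + h *: v))}.
  move=> bc; apply: derivable_within_continuous => s sbc.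
  by have [] := der _ (bc _ sbc).
have a0 : f a = f (a + 0 *: v) by rewrite scale0r addr0.
have [t0|t0] := leP 0 t.
  have bnd s : s \in `[0, t] -> `|s| <= `|t|.
    by rewrite in_itv /= => /andP[s0 st]; rewrite !ger0_norm.
  have [c cin E] := MVT_segment t0
    (fun s sin => der s (bnd s (subset_itv_oo_cc sin))) (cts _ _ bnd).
  by exists c; [exact: bnd|rewrite a0 E subr0 mulrC].
have bnd s : s \in `[t, 0] -> `|s| <= `|t|.
  by rewrite in_itv /= => /andP[ts s0]; rewrite !ler0_norm ?lerN2// ltW.
have [c cin E] := MVT_segment (ltW t0)
  (fun s sin => der s (bnd s (subset_itv_oo_cc sin))) (cts _ _ bnd).
exists c; first exact: bnd.
by rewrite a0 -opprB E sub0r mulrN opprK mulrC.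
Qed.

(** The mean value theorem approximates the increments in the direction $v$ by
    $D_v f(x)$ uniformly in the base point $x + w$. This uniformity yields both
    total differentiability and the symmetry of second derivatives. *)
Lemma strict_partial (R : realType) (V : normedModType R) (U : set V)
    (f : V -> R) (x v : V) (e : R) :
  open U -> U x -> (forall y, U y -> derivable f y v) ->
  {for x, continuous (fun y => 'D_v f y)} -> 0 < e ->
  exists2 d : R, 0 < d & forall w t, `|w| < d -> `|t| < d ->
    U (x + w) /\ U (x + w + t *: v) /\
    `|f (x + w + t *: v) - f (x + w) - t * 'D_v f x| <= e * `|t|.
Proof.
move=> oU Ux fd fc e0.
have /nbhs_ballP[r /= r0 rU] : nbhs x U by exact: open_nbhs_nbhs.
have /cvgrPdist_lt /(_ _ e0) /nbhs_ballP[q /= q0 qc] := fc.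
pose m := Num.min r q.
have m0 : 0 < m by rewrite lt_min r0.
have k0 : 0 < 1 + `|v| by rewrite ltr_pwDl.
exists (m / (1 + `|v|)) => [|w t wd td]; first exact: divr_gt0.
have bnd s : `|s| <= `|t| -> `|w + s *: v| < m.
  move=> st; apply: le_lt_trans (ler_normD _ _) _.
  have -> : m = m / (1 + `|v|) + m / (1 + `|v|) * `|v|.
    by field; rewrite gt_eqF.
  rewrite normrZ ltr_leD// ler_wpM2r// (le_trans st) ?ltW//.
have inb s z : `|s| <= `|t| -> m <= z -> ball x z (x + w + s *: v).
  move=> st mz; rewrite -ball_normE /= -addrA opprD addNKr normrN.
  exact: lt_le_trans (bnd _ st) mz.
have inU s : `|s| <= `|t| -> U (x + w + s *: v).
  by move=> st; apply/rU/inb => //; rewrite ge_min lexx.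
split; first by have := inU 0; rewrite normr0 scale0r addr0; apply.
split; first exact: inU.
have [s st ->] := mean_value_line (f := f) (a := x + w) (v := v) (t := t)
  (fun s st => fd _ (inU s st)).
rewrite -mulrBr normrM mulrC ler_wpM2r// distrC ltW//.
by apply: qc; apply: inb => //; rewrite ge_min lexx orbT.
Qed.

(** Explicit bounds, unlike Landau symbols, can be summed over a list of
    directions. *)
Lemma differentiable_epsP (R : realType) (V W : normedModType R) (f : V -> W)
    (x : V) :
  differentiable f x <->
  exists2 L : {linear V -> W}, continuous L &
    forall e, 0 < e ->
      \forall h \near (0 : V), `|f (h + x) - f x - L h| <= e * `|h|.
Proof.
split=> [df|[L Lc fL]].
  exists ('d f x); first exact: diff_continuous.
  have [_ /eqaddoP fL] := (diff_locallyP x f).1 df.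
  move=> e e0; near=> h.
  have : `|(f \o shift x - (cst (f x) + 'd f x)) h| <= e * `|h|.
    by near: h; apply: fL.
  by rewrite /= opprD addrA; apply.
have fo : f \o shift x = cst (f x) + L +o_ (0 : V) id.
  apply/eqaddoP => e e0; near=> h.
  have : `|f (h + x) - f x - L h| <= e * `|h| by near: h; apply: fL.
  by rewrite -addrA -opprD; apply.
have dE := diff_unique Lc fo.
by apply/diff_locallyP; rewrite dE.
Unshelve. all: by end_near. Qed.

Lemma near_eq_differentiable (R : realType) (V W : normedModType R)
    (f h : V -> W) (x : V) :
  (\forall y \near x, f y = h y) -> differentiable f x -> differentiable h x.
Proof.
move=> fh /differentiable_epsP[L Lc fL]; apply/differentiable_epsP.
exists L => // e e0; near=> k.
rewrite -(nbhs_singleton fh).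
have <- : f (k + x) = h (k + x).
  near: k; have := fh; rewrite (near_shift 0 x) /=.
  by apply: filterS => k; rewrite subr0.
by near: k; apply: fL.
Unshelve. all: by end_near. Qed.

Lemma is_derive_translate (R : realType) (V W : normedModType R) (f : V -> W)
    (a c v : V) (df : W) :
  is_derive (a + c) v f df -> is_derive a v (fun y => f (y + c)) df.
Proof.
case=> fav fdf.
have E : (fun h : R => h^-1 *: (((fun y => f (y + c)) \o shift a) (h *: v)
      - f (a + c)))
    = (fun h : R => h^-1 *: ((f \o shift (a + c)) (h *: v) - f (a + c))).
  by apply/funext => h /=; congr (_ *: (f _ - _)); rewrite addrA.
by split; [rewrite /derivable E | rewrite -fdf /derive E].
Qed.

(** The mean value theorem along $v$ turns the second difference into $t$ times
    an increment of $D_v f$ in the direction $u$, which [strict_partial]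
    estimates. *)
Lemma second_difference (R : realType) (V : normedModType R) (U : set V)
    (f : V -> R) (x u v : V) (e : R) :
  open U -> Ck U 2 f -> U x -> 0 < e ->
  exists2 d : R, 0 < d & forall t, 0 < t < d ->
    `|f (x + t *: v + t *: u) - f (x + t *: v) - (f (x + t *: u) - f x)
      - t ^+ 2 * 'D_u (fun y => 'D_v f y) x| <= e * t ^+ 2.
Proof.
move=> oU [_ fC2] Ux e0.
have [fv [fvc /(_ u)[fvu [fvuc _]]]] := fC2 v.
have [d d0 dP] := strict_partial oU Ux fvu (fvuc _ Ux) e0.
exists (d / (1 + `|v|)) => [|t /andP[t0 td]].
  by rewrite divr_gt0// ltr_pwDl.
have k1 : 1 <= 1 + `|v| by rewrite lerDl.
have k0 : 0 < 1 + `|v| by exact: lt_le_trans k1.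
have [tv_small t_small] : t * `|v| < d /\ t < d.
  have tk : t * (1 + `|v|) < d by rewrite -ltr_pdivlMr.
  split; apply: le_lt_trans tk.
    by rewrite ler_pM2l// lerDr.
  by rewrite ler_peMr// ltW.
have small s : `|s| <= `|t| -> `|s *: v| < d.
  move=> st; rewrite normrZ; apply: le_lt_trans tv_small.
  by rewrite ler_wpM2r// -[leRHS]gtr0_norm.
have tn : `|t| < d by rewrite gtr0_norm.
have der s : `|s| <= `|t| ->
    is_derive (x + s *: v) v (fun y => f (y + t *: u) - f y)
      ('D_v f (x + s *: v + t *: u) - 'D_v f (x + s *: v)).
  move=> st; have [U1 [U2 _]] := dP _ _ (small _ st) tn.
  apply: is_deriveB; last exact/derivableP/fv.
  exact/is_derive_translate/derivableP/fv.
have [s st E] := mean_value_line (f := fun y => f (y + t *: u) - f y)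
  (a := x) (v := v) (t := t) (fun s st => let: DeriveDef d _ := der s st in d).
have [_ [_ bnd]] := dP _ _ (small _ st) tn.
have -> : f (x + t *: v + t *: u) - f (x + t *: v) - (f (x + t *: u) - f x)
   = t * ('D_v f (x + s *: v + t *: u) - 'D_v f (x + s *: v)).
  by rewrite E; congr (_ * _); have [_ ->] := der s st.
rewrite expr2 -mulrA -mulrBr normrM (gtr0_norm t0) mulrCA ler_pM2l//.
by rewrite (gtr0_norm t0) in bnd.
Qed.

(** Both iterated derivatives are limits of the same second difference
    quotient. *)
Lemma derive_comm (R : realType) (V : normedModType R) (U : set V)
    (f : V -> R) (x u v : V) :
  open U -> Ck U 2 f -> U x ->
  'D_u (fun y => 'D_v f y) x = 'D_v (fun y => 'D_u f y) x.
Proof.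
move=> oU fC2 Ux; apply/eqP; rewrite -subr_eq0 -normr_le0.
apply/ler_addgt0Pl => e e0; rewrite addr0.
have e20 : 0 < e / 2 by rewrite divr_gt0.
have [d d0 dP] := second_difference u v oU fC2 Ux e20.
have [d' d0' dP'] := second_difference v u oU fC2 Ux e20.
pose t := Num.min d d' / 2.
have m0 : 0 < Num.min d d' by rewrite lt_min d0.
have t0 : 0 < t by rewrite divr_gt0.
have tm : t < Num.min d d' by rewrite ltr_pdivrMr// ltr_pMr// ltr1n.
move: tm; rewrite lt_min => /andP[td td'].
have := dP t; rewrite t0 td => /(_ isT).
have := dP' t; rewrite t0 td' => /(_ isT).
rewrite [in X in X -> _](addrAC x) opprB.
set A := f (x + _ + _); set B := f (x + _); set C := f (x + _); set D := f x.
set P := 'D_v _ x; set Q := 'D_u _ x => h1 h2.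
have t20 : 0 < t ^+ 2 by rewrite exprn_gt0.
rewrite -(ler_pM2l t20) -[in leLHS](gtr0_norm t20) -normrM.
have -> : t ^+ 2 * (Q - P) = (A - B + (D - C) - t ^+ 2 * P)
    - (A - C - (B - D) - t ^+ 2 * Q) by ring.
apply: le_trans (ler_normB _ _) _; apply: le_trans (lerD h1 h2) _.
by rewrite -mulrDl -splitr mulrC.
Qed.

(** The increment of $f$ is the sum of its increments along successive
    coordinate directions, each of which is controlled by [strict_partial]. *)
Lemma C1_differentiable (R : realType) (n : nat) (U : set 'rV[R]_n)
    (f : 'rV[R]_n -> R) (x : 'rV[R]_n) :
  open U -> Ck U 1 f -> U x -> differentiable f x.
Proof.
move=> oU [_ fC1] Ux.
pose D i := 'D_(basis_vec i) f x.
(* The list of all coordinates, for which the sum below is h itself, is reached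
   by adding one coordinate at a time. *)
have approx (s : seq 'I_n) (e : R) : 0 < e -> \forall h \near (0 : 'rV[R]_n),
    `|f (x + \sum_(i <- s) (h : 'rV[R]_n) 0 i *: basis_vec i) - f x
      - \sum_(i <- s) h 0 i * D i| <= e * `|h|.
  elim: s e => [|i s IHs] e e0.
    near=> h; rewrite !big_nil addr0 !subrr normr0 mulr_ge0// ltW//.
  have e20 : 0 < e / 2 by rewrite divr_gt0.
  have [fi [fic _]] := fC1 (basis_vec i).
  have [d d0 dP] := strict_partial oU Ux fi (fic _ Ux) e20.
  pose C := 1 + \sum_(j <- s) `|basis_vec j : 'rV[R]_n|.
  have C1 : 1 <= C by rewrite lerDl sumr_ge0.
  have C0 : 0 < C by exact: lt_le_trans C1.
  near=> h.
  have coordh j : `|h 0 j| <= `|h|.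
    by rewrite [leRHS]/Num.Def.normr/= mx_normrE; apply: (le_bigmax _ _ (0, j)).
  have hd : `|h| * C < d.
    rewrite -ltr_pdivlMr//; near: h.
    apply/nbhs_ballP; exists (d / C); first exact: divr_gt0.
    by move=> z; rewrite -ball_normE /= sub0r normrN.
  rewrite !big_cons [h 0 i *: _ + _]addrC addrA.
  set w := \sum_(j <- s) _; set S := \sum_(j <- s) _.
  have wd : `|w| < d.
    apply: le_lt_trans hd; apply: le_trans (ler_norm_sum _ _ _) _.
    rewrite /C mulrDr mulr_sumr ler_wpDl ?mulr_ge0//.
    by apply: ler_sum => j _; rewrite normrZ ler_wpM2r.
  have hid : `|h 0 i| < d.
    by apply: le_lt_trans hd; apply: le_trans (coordh i) _; rewrite ler_peMr.
  have [_ [_ b1]] := dP _ _ wd hid.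
  have b2 : `|f (x + w) - f x - S| <= e / 2 * `|h|.
    by rewrite /w /S; near: h; exact: IHs.
  have -> : f (x + w + h 0 i *: basis_vec i) - f x - (h 0 i * D i + S)
    = (f (x + w + h 0 i *: basis_vec i) - f (x + w) - h 0 i * D i)
      + (f (x + w) - f x - S) by ring.
  apply: le_trans (ler_normD _ _) _; rewrite [e]splitr mulrDl lerD//.
  by apply: le_trans b1 _; rewrite ler_wpM2l// ltW.
pose l (h : 'rV[R]_n) : R := \sum_i h 0 i * D i.
have l_lin : linear l.
  move=> a u v; rewrite /l scaler_sumr -big_split; apply: eq_bigr => i _ /=.
  by rewrite !mxE mulrDl -mulrA.
pose lL : {linear 'rV[R]_n -> R} :=
  HB.pack l (GRing.isLinear.Build _ _ _ _ l l_lin).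
apply/differentiable_epsP; exists lL => [h|e e0].
  apply: differentiable_continuous.
  have -> : (lL : _ -> _) = \sum_i ((fun h : 'rV[R]_n => h 0 i) * cst (D i)).
    by apply/funext => k; rewrite fct_sumE.
  apply: differentiable_sum => i; apply: differentiableM => //.
  exact: differentiable_coord.
have := approx (index_enum 'I_n) e e0; apply: filterS => h.
have -> : \sum_(i <- index_enum 'I_n) h 0 i *: basis_vec i = h.
  by rewrite [RHS]row_sum_delta.
by rewrite [x + h]addrC.
Unshelve. all: by end_near. Qed.

Lemma Ck_ext (R : realType) (V W : normedModType R) (U : set V) (k : nat)
    (f h : V -> W) :
  open U -> (forall x, U x -> f x = h x) -> Ck U k f -> Ck U k h.
Proof.
move=> oU; elim: k f h => [|k IHk] f h fh [fc fk].
  split=> // x Ux.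
  have fh_near : \forall y \near x, f y = h y.
    by apply: filterS (open_nbhs_nbhs (conj oU Ux)) => y /fh.
  rewrite /prop_for /continuous_at -(fh _ Ux).
  by apply: cvg_trans (fc x Ux); apply: near_eq_cvg.
have near_fh x : U x -> \forall y \near x, f y = h y.
  by move=> Ux; apply: filterS (open_nbhs_nbhs (conj oU Ux)) => y /fh.
split=> [x Ux|v].
  rewrite /prop_for /continuous_at -(fh _ Ux).
  by apply: cvg_trans (fc x Ux); apply/near_eq_cvg/near_fh.
have [fd fDk] := fk v; split=> [x Ux|].
  exact: near_eq_derivable (near_fh x Ux) (fd x Ux).
by apply: IHk fDk => x /near_fh; exact: near_eq_derive.
Qed.

Lemma Ck_weaken (R : realType) (V W : normedModType R) (U : set V) (k : nat)
    (f : V -> W) : Ck U k.+1 f -> Ck U k f.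
Proof.
elim: k f => [|k IHk] f [fc fk]; split=> // v.
by have [fd fDk] := fk v; split=> //; exact: IHk.
Qed.

Lemma Ck_coord (R : realType) (V : normedModType R) (m n : nat) (U : set V)
    (k : nat) (F : V -> 'M[R]_(m, n)) (i : 'I_m) (j : 'I_n) :
  open U -> Ck U k F -> Ck U k (fun x => F x i j).
Proof.
move=> oU; elim: k F => [|k IHk] F [Fc Fk].
  split=> // x Ux.
  exact: continuous_comp (Fc x Ux) (@coord_continuous _ _ _ i j _).
split=> [x Ux|v].
  exact: continuous_comp (Fc x Ux) (@coord_continuous _ _ _ i j _).
have [Fd FDk] := Fk v; split=> [x Ux|].
  exact: (derivable_mxP F x v).1 (Fd x Ux) i j.
apply: Ck_ext (IHk _ FDk) => // x Ux.
by rewrite derive_mx ?mxE//; exact: Fd.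
Qed.

(** * Matrix-valued maps *)

Section MatrixCalculus.
Context {R : realType} {V : normedModType R}.

Lemma is_derive_mxP m n (M : V -> 'M[R]_(m, n)) x v dM :
  is_derive x v M dM <->
  forall i j, is_derive x v (fun y => M y i j) (dM i j).
Proof.
split=> [[Md <-] i j|Mij].
  split; first exact: (derivable_mxP M x v).1 Md i j.
  by rewrite derive_mx// mxE.
have Md : derivable M x v.
  by apply/derivable_mxP => i j; have [] := Mij i j.
split=> //; rewrite derive_mx//; apply/matrixP => i j.
by rewrite mxE; have [_ ->] := Mij i j.
Qed.

Lemma is_derive_mulmx m n p (A : V -> 'M[R]_(m, n)) (B : V -> 'M[R]_(n, p))
    x v dA dB :
  is_derive x v A dA -> is_derive x v B dB ->
  is_derive x v (fun y => A y *m B y) (dA *m B x + A x *m dB).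
Proof.
move=> /is_derive_mxP Ad /is_derive_mxP Bd; apply/is_derive_mxP => i j.
have -> : (fun y => (A y *m B y) i j)
    = \sum_k ((fun y => A y i k) * (fun y => B y k j)).
  by apply/funext => y; rewrite mxE fct_sumE.
apply: is_derive_eq; rewrite !mxE -big_split; apply: eq_bigr => k _ /=.
by rewrite addrC; congr (_ + _); exact: mulrC.
Qed.

Lemma is_derive_trmx m n (A : V -> 'M[R]_(m, n)) x v dA :
  is_derive x v A dA -> is_derive x v (fun y => (A y)^T) dA^T.
Proof.
move=> /is_derive_mxP Ad; apply/is_derive_mxP => i j; rewrite mxE.
by under eq_fun do rewrite mxE; exact: Ad.
Qed.

Lemma is_derive_row_mx n p (A : V -> 'rV[R]_n) (B : V -> 'rV[R]_p) x v dA dB :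
  is_derive x v A dA -> is_derive x v B dB ->
  is_derive x v (fun y => row_mx (A y) (B y)) (row_mx dA dB).
Proof.
move=> /is_derive_mxP Ad /is_derive_mxP Bd; apply/is_derive_mxP => i j.
rewrite -(splitK j); case: (fintype.split j) => k /=.
  by rewrite row_mxEl; under eq_fun do rewrite row_mxEl; exact: Ad.
by rewrite row_mxEr; under eq_fun do rewrite row_mxEr; exact: Bd.
Qed.

Lemma is_derive_scale n (f : V -> R) (A : V -> 'rV[R]_n) x v df dA :
  is_derive x v f df -> is_derive x v A dA ->
  is_derive x v (fun y => f y *: A y) (df *: A x + f x *: dA).
Proof.
move=> fd /is_derive_mxP Ad; apply/is_derive_mxP => i j.
have -> : (fun y => (f y *: A y) i j) = f * (fun y => A y i j).
  by apply/funext => y; rewrite mxE.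
by apply: is_derive_eq; rewrite !mxE addrC; congr (_ + _); exact: mulrC.
Qed.

(** Entrywise, so that closure under algebraic operations reduces to the case of
    real-valued maps. *)
Definition diff_mx m n (M : V -> 'M[R]_(m, n)) (x : V) : Prop :=
  forall i j, differentiable (fun y => M y i j) x.

Lemma diff_mx_derivable m n (M : V -> 'M[R]_(m, n)) x v :
  diff_mx M x -> is_derive x v M ('D_v M x).
Proof.
by move=> Md; apply/derivableP/derivable_mxP => i j; exact: diff_derivable.
Qed.

Lemma diff_mx_linear m n (M : V -> 'M[R]_(m, n)) x a u v :
  diff_mx M x -> 'D_(a *: u + v) M x = a *: 'D_u M x + 'D_v M x.
Proof.
move=> Md; have dM w : derivable M x w by have [] := diff_mx_derivable w Md.
apply/matrixP => i j; rewrite !derive_mx// !mxE !deriveE//.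
by rewrite linearP.
Qed.

Lemma diff_mx_cst m n (A : 'M[R]_(m, n)) x : diff_mx (fun=> A) x.
Proof. by move=> i j; exact: differentiable_cst. Qed.

Lemma diff_mxD m n (A B : V -> 'M[R]_(m, n)) x :
  diff_mx A x -> diff_mx B x -> diff_mx (fun y => A y + B y) x.
Proof.
move=> Ad Bd i j.
have -> : (fun y => (A y + B y) i j) = (fun y => A y i j) + (fun y => B y i j).
  by apply/funext => y; rewrite mxE.
exact: differentiableD.
Qed.

Lemma diff_mxM m n p (A : V -> 'M[R]_(m, n)) (B : V -> 'M[R]_(n, p)) x :
  diff_mx A x -> diff_mx B x -> diff_mx (fun y => A y *m B y) x.
Proof.
move=> Ad Bd i j.
have -> : (fun y => (A y *m B y) i j)
    = \sum_k ((fun y => A y i k) * (fun y => B y k j)).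
  by apply/funext => y; rewrite mxE fct_sumE.
by apply: differentiable_sum => k; exact: differentiableM.
Qed.

Lemma diff_mx_trmx m n (A : V -> 'M[R]_(m, n)) x :
  diff_mx A x -> diff_mx (fun y => (A y)^T) x.
Proof. by move=> Ad i j; under eq_fun do rewrite mxE; exact: Ad. Qed.

Lemma differentiable_det n (A : V -> 'M[R]_n) x :
  diff_mx A x -> differentiable (fun y => \det (A y)) x.
Proof.
move=> Ad; have prod_diff (s : seq 'I_n) (t : 'S_n) :
    differentiable (fun y => \prod_(i <- s) A y i (t i)) x.
  elim: s => [|i s IHs].
    by under eq_fun do rewrite big_nil; exact: differentiable_cst.
  by under eq_fun do rewrite big_cons; exact: differentiableM.
have det_diff (s : seq 'S_n) : differentiable
    (fun y => \sum_(t <- s) (-1) ^+ t * \prod_i A y i (t i)) x.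
  elim: s => [|t s IHs].
    by under eq_fun do rewrite big_nil; exact: differentiable_cst.
  under eq_fun do rewrite big_cons.
  apply: differentiableD => //; apply: differentiableM => //.
exact: det_diff.
Qed.

(** By Cramer's rule the entries of the inverse are cofactors divided by the
    determinant. *)
Lemma diff_mx_invmx n (A : V -> 'M[R]_n) x :
  (\forall y \near x, A y \in unitmx) -> diff_mx A x ->
  diff_mx (fun y => invmx (A y)) x.
Proof.
move=> Au Ad i j.
have cof_diff : differentiable (fun y => cofactor (A y) j i) x.
  apply: differentiableM => //; apply: differentiable_det => k l.
  by under eq_fun do rewrite !mxE; exact: Ad.
apply: (@near_eq_differentiable _ _ _
  (fun y => (\det (A y))^-1 * cofactor (A y) j i)).
  by apply: filterS Au => y Ay; rewrite /invmx Ay !mxE.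
apply: differentiableM => //; apply: differentiableV.
  exact: differentiable_det.
by have := nbhs_singleton Au; rewrite /= unitmxE unitfE.
Qed.

End MatrixCalculus.

Lemma derive_comm_mx (R : realType) (V : normedModType R) (m n : nat)
    (U : set V) (M : V -> 'M[R]_(m, n)) (x u v : V) :
  open U -> Ck U 2 M -> U x ->
  'D_u (fun y => 'D_v M y) x = 'D_v (fun y => 'D_u M y) x.
Proof.
move=> oU M2 Ux; have [_ MC] := M2.
have Mij a i j : \forall y \near x,
    ('D_a M y) i j = 'D_a (fun z => M z i j) y.
  apply: filterS (open_nbhs_nbhs (conj oU Ux)) => y Uy.
  by rewrite derive_mx ?mxE//; have [Md _] := MC a; exact: Md.
have MD a b : derivable (fun y => 'D_a M y) x b.
  by have [_ [_ MDC]] := MC a; have [Md _] := MDC b; exact: Md.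
apply/matrixP => i j; rewrite (derive_mx (MD v u)) (derive_mx (MD u v)).
rewrite [LHS]mxE [RHS]mxE.
rewrite (near_eq_derive _ (Mij v i j)) (near_eq_derive _ (Mij u i j)).
exact: derive_comm oU (Ck_coord i j oU M2) Ux.
Qed.

(** * Bilinear forms and the Koszul formula *)

Section BilinearForms.
Context {R : realType} {m n : nat}.
Implicit Types (A : 'M[R]_(m, n)) (u : 'rV[R]_m) (v : 'rV[R]_n).

Definition bform A u v : R := (u *m A *m v^T) 0 0.

Lemma bformDl A u u' v : bform A (u + u') v = bform A u v + bform A u' v.
Proof. by rewrite /bform !mulmxDl mxE. Qed.

Lemma bformDr A u v v' : bform A u (v + v') = bform A u v + bform A u v'.
Proof. by rewrite /bform linearD mulmxDr mxE. Qed.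

Lemma bformZl A a u v : bform A (a *: u) v = a * bform A u v.
Proof. by rewrite /bform -!scalemxAl mxE. Qed.

Lemma bformZr A a u v : bform A u (a *: v) = a * bform A u v.
Proof. by rewrite /bform linearZ -scalemxAr mxE. Qed.

Lemma bformE A u v :
  bform A u v = \sum_i \sum_j u 0 i * v 0 j * A i j.
Proof.
rewrite /bform mxE exchange_big; apply: eq_bigr => j _ /=.
rewrite !mxE mulr_suml; apply: eq_bigr => i _.
by rewrite mulrAC.
Qed.

Lemma bform_lin_mx A B a u v :
  bform (a *: A + B) u v = a * bform A u v + bform B u v.
Proof.
rewrite /bform mulmxDr mulmxDl [LHS]mxE -scalemxAr -scalemxAl.
by rewrite [X in X + _]mxE.
Qed.

Lemma bform_delta A u (j : 'I_n) : bform A u (delta_mx 0 j) = (u *m A) 0 j.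
Proof.
rewrite /bform mxE (bigD1 j)//= big1 ?addr0 => [|k kj].
  by rewrite [_^T _ _]mxE [delta_mx _ _ _ _]mxE !eqxx mulr1.
by rewrite [_^T _ _]mxE [delta_mx _ _ _ _]mxE (negbTE kj) andbF mulr0.
Qed.

Lemma bform_sum_delta A u v :
  bform A u v = \sum_j v 0 j * bform A u (delta_mx 0 j).
Proof.
rewrite /bform [LHS]mxE; apply: eq_bigr => j _.
by rewrite -/(bform A u _) bform_delta [_^T _ _]mxE mulrC.
Qed.

Lemma bform_sum (I : finType) (c : I -> R) (A : I -> 'M[R]_(m, n)) u v :
  bform (\sum_i c i *: A i) u v = \sum_i c i * bform (A i) u v.
Proof.
rewrite /bform mulmx_sumr mulmx_suml summxE; apply: eq_bigr => i _.
by rewrite -scalemxAr -scalemxAl mxE.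
Qed.

End BilinearForms.

Lemma bform_trmx (R : realType) (m n : nat) (A : 'M[R]_(m, n)) u v :
  bform A^T v u = bform A u v.
Proof.
rewrite !bformE exchange_big; apply: eq_bigr => i _; apply: eq_bigr => j _.
by rewrite mxE [v 0 j * _]mulrC.
Qed.

(** Recovers the Sasaki form from its matrix, which is given by values on basis
    vectors. *)
Lemma bform_of_bilinear (R : realType) (n : nat)
    (F : 'rV[R]_n -> 'rV[R]_n -> R) :
  (forall a u u' v, F (a *: u + u') v = a * F u v + F u' v) ->
  (forall a u v v', F u (a *: v + v') = a * F u v + F u v') ->
  forall u v,
    bform (\matrix_(i, j) F (delta_mx 0 i) (delta_mx 0 j)) u v = F u v.
Proof.
move=> Fl Fr u v.
have Fr0 w : F w 0 = 0.
  by have := Fr 1 w 0 0; rewrite scaler0 addr0 mul1r => /eqP;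
    rewrite -subr_eq subrr eq_sym => /eqP.
have Fl0 w : F 0 w = 0.
  by have := Fl 1 0 0 w; rewrite scaler0 addr0 mul1r => /eqP;
    rewrite -subr_eq subrr eq_sym => /eqP.
have Fsuml (s : seq 'I_n) c w : F (\sum_(i <- s) c i *: delta_mx 0 i) w
    = \sum_(i <- s) c i * F (delta_mx 0 i) w.
  by elim: s => [|i s IHs]; rewrite ?big_nil ?Fl0// !big_cons Fl IHs.
have Fsumr (s : seq 'I_n) c w : F w (\sum_(i <- s) c i *: delta_mx 0 i)
    = \sum_(i <- s) c i * F w (delta_mx 0 i).
  by elim: s => [|i s IHs]; rewrite ?big_nil ?Fr0// !big_cons Fr IHs.
rewrite bformE [in RHS](row_sum_delta u) Fsuml; apply: eq_bigr => i _.
rewrite [in RHS](row_sum_delta v) Fsumr mulr_sumr; apply: eq_bigr => j _.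
by rewrite mxE mulrA.
Qed.

Lemma is_derive_bform (R : realType) (V : normedModType R) (m n : nat)
    (A : V -> 'M[R]_(m, n)) (X : V -> 'rV[R]_m) (Y : V -> 'rV[R]_n)
    x w dA dX dY :
  is_derive x w A dA -> is_derive x w X dX -> is_derive x w Y dY ->
  is_derive x w (fun y => bform (A y) (X y) (Y y))
    (bform dA (X x) (Y x) + bform (A x) dX (Y x) + bform (A x) (X x) dY).
Proof.
move=> Ad Xd Yd.
have := is_derive_mulmx (is_derive_mulmx Xd Ad) (is_derive_trmx Yd).
move=> /is_derive_mxP /(_ 0 0) H; apply: is_derive_eq H _.
by rewrite mulmxDl mxE [X in X + _]mxE /bform; congr (_ + _); rewrite addrC.
Qed.

Lemma diff_bform (R : realType) (V : normedModType R) (m n : nat)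
    (A : V -> 'M[R]_(m, n)) (X : V -> 'rV[R]_m) (Y : V -> 'rV[R]_n) x :
  diff_mx A x -> diff_mx X x -> diff_mx Y x ->
  differentiable (fun y => bform (A y) (X y) (Y y)) x.
Proof.
by move=> Ad Xd Yd; exact: (diff_mxM (diff_mxM Xd Ad) (diff_mx_trmx Yd) 0 0).
Qed.

(** Locked, since unification would otherwise compare derivatives in different
    directions by unfolding the limits that define them. *)
HB.lock Definition dmetric (R : realType) (n : nat)
    (g : 'rV[R]_n -> 'M[R]_n) (x w u v : 'rV[R]_n) : R :=
  bform ('D_w g x) u v.

Section Metric.
Context {R : realType} {n : nat}.
Implicit Types (g G : 'rV[R]_n -> 'M[R]_n) (x u v w : 'rV[R]_n).

Lemma inner_bform g x u v : inner g x u v = bform (g x) u v.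
Proof. by []. Qed.

Lemma innerDl g x u u' v :
  inner g x (u + u') v = inner g x u v + inner g x u' v.
Proof. exact: bformDl. Qed.

Lemma innerDr g x u v v' :
  inner g x u (v + v') = inner g x u v + inner g x u v'.
Proof. exact: bformDr. Qed.

Lemma innerZl g x a u v : inner g x (a *: u) v = a * inner g x u v.
Proof. exact: bformZl. Qed.

Lemma innerZr g x a u v : inner g x u (a *: v) = a * inner g x u v.
Proof. exact: bformZr. Qed.

Lemma innerNl g x u v : inner g x (- u) v = - inner g x u v.
Proof. by rewrite -scaleN1r innerZl mulN1r. Qed.

Lemma innerNr g x u v : inner g x u (- v) = - inner g x u v.
Proof. by rewrite -scaleN1r innerZr mulN1r. Qed.

Lemma inner0l g x v : inner g x 0 v = 0.
Proof. by have := innerZl g x 0 0 v; rewrite scaler0 mul0r. Qed.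

Lemma inner0r g x u : inner g x u 0 = 0.
Proof. by have := innerZr g x 0 u 0; rewrite scaler0 mul0r. Qed.

Definition christoffel_mx g x (k : 'I_n) : 'M[R]_n :=
  \matrix_(i, j) christoffel g x i j k.

Lemma gamma_bform g x u v k :
  gamma g x u v 0 k = bform (christoffel_mx g x k) u v.
Proof.
rewrite mxE bformE; apply: eq_bigr => i _; apply: eq_bigr => j _.
by rewrite mxE.
Qed.

Lemma gammaDl g x u u' v :
  gamma g x (u + u') v = gamma g x u v + gamma g x u' v.
Proof. by apply/rowP => k; rewrite [RHS]mxE !gamma_bform bformDl. Qed.

Lemma gammaDr g x u v v' :
  gamma g x u (v + v') = gamma g x u v + gamma g x u v'.
Proof. by apply/rowP => k; rewrite [RHS]mxE !gamma_bform bformDr. Qed.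

Lemma gammaZl g x a u v : gamma g x (a *: u) v = a *: gamma g x u v.
Proof. by apply/rowP => k; rewrite [RHS]mxE !gamma_bform bformZl. Qed.

Lemma gammaZr g x a u v : gamma g x u (a *: v) = a *: gamma g x u v.
Proof. by apply/rowP => k; rewrite [RHS]mxE !gamma_bform bformZr. Qed.

Lemma gamma0l g x v : gamma g x 0 v = 0.
Proof. by have := gammaZl g x 0 0 v; rewrite !scale0r. Qed.

Lemma gamma0r g x u : gamma g x u 0 = 0.
Proof. by have := gammaZr g x 0 u 0; rewrite !scale0r. Qed.

Lemma diff_mx_sum_delta m p (G : 'rV[R]_n -> 'M[R]_(m, p)) x u :
  diff_mx G x -> 'D_u G x = \sum_i u 0 i *: 'D_(basis_vec i) G x.
Proof.
move=> Gd.
have D_lin : linear (fun u => 'D_u G x) by move=> a v w; exact: diff_mx_linear.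
pose D : {linear 'rV[R]_n -> 'M[R]_(m, p)} :=
  HB.pack (fun u => 'D_u G x) (GRing.isLinear.Build _ _ _ _ _ D_lin).
rewrite -[LHS]/(D u) [in LHS](row_sum_delta u) linear_sum.
by apply: eq_bigr => i _; rewrite linearZ.
Qed.

(** The Koszul formula for coordinate fields: contracting the Christoffel
    symbols with the metric cancels the inverse matrix. *)
Lemma koszul G x u v w :
  diff_mx G x -> (G x)^T = G x -> G x \in unitmx ->
  inner G x (gamma G x u v) w
  = 2^-1 * (dmetric G x u v w + dmetric G x v u w - dmetric G x w u v).
Proof.
move=> Gd Gs Gu; rewrite !dmetric.unlock.
have Gdij i j k : partial k (fun y => G y i j) x = ('D_(basis_vec k) G x) i j.
  rewrite /partial derive_mx ?mxE//.
  by have [] := diff_mx_derivable (basis_vec k) Gd.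
pose T i j l := ('D_(basis_vec i) G x) j l + ('D_(basis_vec j) G x) i l
  - ('D_(basis_vec l) G x) i j.
pose c : 'rV[R]_n := \row_l (bform ('D_u G x) v (basis_vec l)
  + bform ('D_v G x) u (basis_vec l) - bform ('D_(basis_vec l) G x) u v).
have cE l : c 0 l = \sum_i \sum_j u 0 i * v 0 j * T i j l.
  rewrite mxE !bform_delta (diff_mx_sum_delta u Gd) (diff_mx_sum_delta v Gd).
  have -> : (v *m \sum_i u 0 i *: 'D_(basis_vec i) G x) 0 l
      = \sum_i \sum_j u 0 i * v 0 j * ('D_(basis_vec i) G x) j l.
    rewrite mulmx_sumr summxE; apply: eq_bigr => i _.
    rewrite -scalemxAr [LHS]mxE [X in _ * X]mxE mulr_sumr.
    by apply: eq_bigr => j _; rewrite mulrA.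
  have -> : (u *m \sum_i v 0 i *: 'D_(basis_vec i) G x) 0 l
      = \sum_i \sum_j u 0 i * v 0 j * ('D_(basis_vec j) G x) i l.
    rewrite mulmx_sumr summxE exchange_big; apply: eq_bigr => i _.
    rewrite -scalemxAr [LHS]mxE [X in _ * X]mxE mulr_sumr.
    by apply: eq_bigr => j _; rewrite mulrA [v 0 i * _]mulrC.
  rewrite bformE -big_split -sumrB; apply: eq_bigr => i _ /=.
  rewrite -big_split -sumrB; apply: eq_bigr => j _ /=.
  by rewrite /T mulrBr mulrDr.
have -> : gamma G x u v = 2^-1 *: (c *m (invmx (G x))^T).
  apply/rowP => k; rewrite [LHS]mxE [RHS]mxE [X in _ = _ * X]mxE.
  under [in RHS]eq_bigr => l _ do rewrite cE mulr_suml.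
  rewrite [in RHS]exchange_big mulr_sumr; apply: eq_bigr => i _ /=.
  under [in RHS]eq_bigr => l _ do rewrite mulr_suml.
  rewrite [in RHS]exchange_big mulr_sumr; apply: eq_bigr => j _ /=.
  rewrite mulrCA; congr (_ * _); rewrite mulr_sumr; apply: eq_bigr => l _.
  by rewrite !Gdij [_^T _ _]mxE -mulrA [T i j l * _]mulrC.
rewrite inner_bform bformZl; congr (_ * _).
have cancel_inv : (invmx (G x))^T *m G x = 1%:M.
  by rewrite -{2}Gs -trmx_mul mulmxV// trmx1.
rewrite {1}/bform -(mulmxA c) cancel_inv mulmx1 mxE.
rewrite (bform_sum_delta _ v) (bform_sum_delta _ u w) (diff_mx_sum_delta w Gd).
rewrite bform_sum -big_split -sumrB; apply: eq_bigr => l _ /=.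
by rewrite [w^T _ _]mxE mulrC -mulrDr -mulrBr [c 0 l]mxE.
Qed.

End Metric.

(** Locked for the same reason as [dmetric]. *)
HB.lock Definition dgamma (R : realType) (n : nat)
    (g : 'rV[R]_n -> 'M[R]_n) (x w u v : 'rV[R]_n) : 'rV[R]_n :=
  \row_k bform ('D_w (fun y => christoffel_mx g y k) x) u v.

(** * The Levi-Civita connection *)

Lemma posdef_unitmx (R : realType) (n : nat) (A : 'M[R]_n) :
  (forall v : 'rV_n, v != 0 -> 0 < bform A v v) -> A \in unitmx.
Proof.
move=> Apos; rewrite unitmxE unitfE; apply/det0P => -[v v0 vA].
by have := Apos v v0; rewrite /bform vA mul0mx mxE ltxx.
Qed.

Record metric_on (R : realType) (n : nat) (U : set 'rV[R]_n)
    (g : 'rV[R]_n -> 'M[R]_n) : Prop := MetricOn {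
  metric_open : open U;
  metric_C2 : Ck U 2 g;
  metric_sym : forall x, U x -> (g x)^T = g x;
  metric_pos : forall x, U x -> forall v : 'rV[R]_n, v != 0 ->
    0 < inner g x v v
}.

Section MetricOn.
Context {R : realType} {n : nat} {U : set 'rV[R]_n} {g : 'rV[R]_n -> 'M[R]_n}.
Hypothesis gU : metric_on U g.
Implicit Types (x u v w : 'rV[R]_n) (X Y : 'rV[R]_n -> 'rV[R]_n).

Lemma near_dom x : U x -> \forall y \near x, U y.
Proof. by move=> Ux; exact: open_nbhs_nbhs (conj (metric_open gU) Ux). Qed.

Lemma Ck1_diff_mx m p (M : 'rV[R]_n -> 'M[R]_(m, p)) x :
  Ck U 1 M -> U x -> diff_mx M x.
Proof.
move=> M1 Ux i j; apply: (C1_differentiable (metric_open gU)) => //.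
exact: Ck_coord (metric_open gU) M1.
Qed.

Lemma metric_diff_mx x : U x -> diff_mx g x.
Proof. exact: Ck1_diff_mx (Ck_weaken (metric_C2 gU)). Qed.

Lemma metric_unit x : U x -> g x \in unitmx.
Proof. by move=> Ux; exact/posdef_unitmx/(metric_pos gU). Qed.

Lemma inner_sym x u v : U x -> inner g x u v = inner g x v u.
Proof. by move=> Ux; rewrite !inner_bform -bform_trmx (metric_sym gU). Qed.

Lemma inner_ext x u v :
  U x -> (forall w, inner g x u w = inner g x v w) -> u = v.
Proof.
move=> Ux uv; apply/eqP; rewrite -subr_eq0; apply/negPn/negP => uv0.
have := metric_pos gU Ux uv0.
by rewrite inner_bform bformDl -scaleN1r bformZl -!inner_bform uv mulN1r
  subrr ltxx.
Qed.

Lemma derive_metric_sym x u v w : U x ->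
  dmetric g x w u v = dmetric g x w v u.
Proof.
move=> Ux; rewrite dmetric.unlock -bform_trmx; congr (bform _ _ _).
have [gd _] := diff_mx_derivable w (metric_diff_mx Ux).
apply/matrixP => i j; rewrite mxE !derive_mx// !mxE; apply: near_eq_derive.
apply: filterS (near_dom Ux) => y Uy.
by rewrite -[in RHS](metric_sym gU Uy) mxE.
Qed.

Lemma gammaC x u v : U x -> gamma g x u v = gamma g x v u.
Proof.
move=> Ux; apply: (inner_ext Ux) => w.
have gd := metric_diff_mx Ux; have gs := metric_sym gU Ux.
rewrite !koszul//; try exact: metric_unit.
by rewrite (derive_metric_sym u v w Ux) [dmetric _ _ _ v w + _]addrC.
Qed.

(** Compatibility of the connection with the metric: in the sum of the two
    Koszul formulas the other derivatives cancel. *)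
Lemma derive_metric x u v w : U x ->
  dmetric g x w u v
  = inner g x (gamma g x w u) v + inner g x u (gamma g x w v).
Proof.
move=> Ux; rewrite [X in _ + X]inner_sym//.
have gd := metric_diff_mx Ux; have gs := metric_sym gU Ux.
rewrite !koszul//; try exact: metric_unit.
rewrite (derive_metric_sym v u w Ux).
move: (dmetric _ _ _ u v) (dmetric _ _ _ w v) (dmetric _ _ _ w u) => a b c.
by field.
Qed.

Lemma is_derive_inner X Y x w : U x ->
  derivable X x w -> derivable Y x w ->
  is_derive x w (fun y => inner g y (X y) (Y y))
    (inner g x (cov g w X x) (Y x) + inner g x (X x) (cov g w Y x)).
Proof.
move=> Ux /derivableP Xd /derivableP Yd.
have H := is_derive_bform (diff_mx_derivable w (metric_diff_mx Ux)) Xd Yd.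
apply: is_derive_eq H _.
have -> : bform ('D_w g x) (X x) (Y x) = dmetric g x w (X x) (Y x).
  by rewrite dmetric.unlock.
rewrite derive_metric// /cov !inner_bform bformDl bformDr -addrA addrACA.
by congr (_ + _); rewrite addrC.
Qed.

Lemma christoffel_diff_mx x k : U x ->
  diff_mx (fun y => christoffel_mx g y k) x.
Proof.
move=> Ux i j; under eq_fun do rewrite mxE.
pose P a b c y := partial a (fun z => g z b c) y.
have P_diff a b c : differentiable (P a b c) x.
  apply: (C1_differentiable (metric_open gU)) => //.
  have [_ gC] := Ck_coord b c (metric_open gU) (metric_C2 gU).
  by have [] := gC (basis_vec a).
have inv_diff := diff_mx_invmx (filterS (@metric_unit) (near_dom Ux))
  (metric_diff_mx Ux).
have sum_diff : differentiable (\sum_l ((fun y => invmx (g y) k l)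
    * (P i j l + P j i l - P l i j))) x.
  apply: differentiable_sum => l; apply: differentiableM; first exact: inv_diff.
  by apply: differentiableB; [exact: differentiableD|].
have -> : (fun y => christoffel g y i j k) = 2^-1 *: (\sum_l
    ((fun y => invmx (g y) k l) * (P i j l + P j i l - P l i j))).
  by apply/funext => y; rewrite /christoffel scalrfctE fct_sumE.
exact: differentiableZ.
Qed.

Lemma dgammaE x w u v k :
  dgamma g x w u v 0 k = bform ('D_w (fun y => christoffel_mx g y k) x) u v.
Proof. by rewrite dgamma.unlock mxE. Qed.

Lemma is_derive_gamma X Y x w : U x -> derivable X x w -> derivable Y x w ->
  is_derive x w (fun y => gamma g y (X y) (Y y))
    (dgamma g x w (X x) (Y x) + gamma g x ('D_w X x) (Y x)
     + gamma g x (X x) ('D_w Y x)).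
Proof.
move=> Ux /derivableP Xd /derivableP Yd; apply/is_derive_mxP => i k.
rewrite ord1; under eq_fun do rewrite gamma_bform.
have H := is_derive_bform
  (diff_mx_derivable w (christoffel_diff_mx k Ux)) Xd Yd.
apply: is_derive_eq H _.
by rewrite -!gamma_bform -dgammaE [RHS]mxE [X in _ = X + _]mxE.
Qed.

Lemma dgamma_linear_dir x a w w' u v : U x ->
  dgamma g x (a *: w + w') u v = a *: dgamma g x w u v + dgamma g x w' u v.
Proof.
move=> Ux; apply/rowP => k; rewrite [RHS]mxE [X in _ = X + _]mxE !dgammaE.
rewrite -bform_lin_mx; congr (bform _ _ _).
exact: diff_mx_linear (christoffel_diff_mx k Ux).
Qed.

Lemma dgammaDl x w u u' v :
  dgamma g x w (u + u') v = dgamma g x w u v + dgamma g x w u' v.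
Proof. by apply/rowP => k; rewrite [RHS]mxE !dgammaE bformDl. Qed.

Lemma dgammaDr x w u v v' :
  dgamma g x w u (v + v') = dgamma g x w u v + dgamma g x w u v'.
Proof. by apply/rowP => k; rewrite [RHS]mxE !dgammaE bformDr. Qed.

Lemma dgammaZl x w a u v : dgamma g x w (a *: u) v = a *: dgamma g x w u v.
Proof. by apply/rowP => k; rewrite [RHS]mxE !dgammaE bformZl. Qed.

Lemma dgammaZr x w a u v : dgamma g x w u (a *: v) = a *: dgamma g x w u v.
Proof. by apply/rowP => k; rewrite [RHS]mxE !dgammaE bformZr. Qed.

Lemma curvE x u v w : U x ->
  curv g x u v w = dgamma g x u v w - dgamma g x v u w
    + gamma g x u (gamma g x v w) - gamma g x v (gamma g x u w).
Proof.
move=> Ux.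
have D a b : 'D_a (fun y => cov g b (fun=> w) y) x = dgamma g x a b w.
  have -> : (fun y => cov g b (fun=> w) y) = (fun y => gamma g y b w).
    by apply/funext => y; rewrite /cov derive_cst add0r.
  have [_ ->] := is_derive_gamma Ux (derivable_cst b x a) (derivable_cst w x a).
  by rewrite !derive_cst gamma0l gamma0r !addr0.
rewrite /curv [cov g u _ x]/cov [cov g v _ x in X in _ - X]/cov !D.
by rewrite {1 2}/cov !derive_cst !add0r opprD addrACA addrA.
Qed.

End MetricOn.

(** * Curvature *)

Section Curvature.
Context {R : realType} {n : nat} {U : set 'rV[R]_n} {g : 'rV[R]_n -> 'M[R]_n}.
Hypothesis gU : metric_on U g.
Implicit Types (x u v w : 'rV[R]_n) (X Y : 'rV[R]_n -> 'rV[R]_n).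

Let distribute (a : R) (A B C D A' B' C' D' : 'rV[R]_n) :
  a *: A + A' - (a *: B + B') + (a *: C + C') - (a *: D + D')
  = a *: (A - B + C - D) + (A' - B' + C' - D').
Proof. by apply/rowP => k; rewrite !mxE; ring. Qed.

Lemma curv_antisym x u v w : curv g x v u w = - curv g x u v w.
Proof. by rewrite /curv opprB. Qed.

Lemma curv_linear1 x a u u' v w : U x ->
  curv g x (a *: u + u') v w = a *: curv g x u v w + curv g x u' v w.
Proof.
move=> Ux; rewrite !(curvE gU)// (dgamma_linear_dir gU)//.
by rewrite dgammaDl dgammaZl !gammaDl !gammaZl gammaDr gammaZr distribute.
Qed.

Lemma curv_linear2 x a u v v' w : U x ->
  curv g x u (a *: v + v') w = a *: curv g x u v w + curv g x u v' w.
Proof.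
move=> Ux; rewrite curv_antisym curv_linear1// opprD -scalerN.
by rewrite -!curv_antisym.
Qed.

Lemma curv_same x u w : curv g x u u w = 0.
Proof. by rewrite /curv subrr. Qed.

Lemma curvZl x a u v w : U x -> curv g x (a *: u) v w = a *: curv g x u v w.
Proof.
move=> Ux; have curv0 : curv g x 0 v w = 0.
  have := curv_linear1 1 0 0 v w Ux; rewrite scaler0 addr0 scale1r => /eqP.
  by rewrite -subr_eq subrr eq_sym => /eqP.
by have := curv_linear1 a u 0 v w Ux; rewrite curv0 !addr0.
Qed.

Lemma curvZr x a u v w : U x -> curv g x u (a *: v) w = a *: curv g x u v w.
Proof. by move=> Ux; rewrite curv_antisym curvZl// -scalerN -curv_antisym. Qed.

Lemma curv_linear3 x a u v w w' : U x ->
  curv g x u v (a *: w + w') = a *: curv g x u v w + curv g x u v w'.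
Proof.
move=> Ux; rewrite !(curvE gU)//.
by rewrite !dgammaDr !dgammaZr !gammaDr !gammaZr distribute.
Qed.

(** The Ricci identity: for constant fields $u$, $v$ the commutator of the
    covariant derivatives is tensorial, since the second derivatives of $Y$
    cancel. *)
Lemma cov_comm Y x u v : Ck U 2 Y -> U x ->
  cov g u (fun y => cov g v Y y) x - cov g v (fun y => cov g u Y y) x
  = curv g x u v (Y x).
Proof.
move=> Y2 Ux.
have Yd a : derivable Y x a.
  by have [] := diff_mx_derivable a (Ck1_diff_mx gU (Ck_weaken Y2) Ux).
have DYd a b : derivable (fun y => 'D_a Y y) x b.
  have [_ YC] := Y2; have [_ YaC] := YC a.
  by have [] := diff_mx_derivable b (Ck1_diff_mx gU YaC Ux).
have covD a b : 'D_a (fun y => cov g b Y y) x = 'D_a (fun y => 'D_b Y y) x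
    + (dgamma g x a b (Y x) + gamma g x b ('D_a Y x)).
  have [_ D] := is_deriveD (derivableP (DYd b a))
    (is_derive_gamma gU Ux (derivable_cst b x a) (Yd a)).
  by rewrite derive_cst gamma0l addr0 in D; exact: D.
rewrite (curvE gU) // [cov g u _ x in LHS]/cov [cov g v _ x in X in _ - X]/cov.
rewrite (covD u v) (covD v u) (derive_comm_mx v u (metric_open gU) Y2 Ux).
rewrite [cov g v Y x]/cov [cov g u Y x]/cov !gammaDr.
move: ('D_u (fun y => 'D_v Y y) x).
move: (dgamma g x u v (Y x)) (dgamma g x v u (Y x)).
move: (gamma g x v ('D_u Y x)) (gamma g x u ('D_v Y x)).
move: (gamma g x u (gamma g x v (Y x))) (gamma g x v (gamma g x u (Y x))).
move=> a b c d e f h; apply/rowP => k; rewrite !mxE; ring.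
Qed.

End Curvature.

(** * The Sasaki metric *)

Lemma is_derive_lsubmx (R : realType) (W : normedModType R) (n m : nat)
    (F : 'rV[R]_n -> W) (z w : 'rV[R]_(n + m)) (dF : W) :
  is_derive (lsubmx z) (lsubmx w) F dF ->
  is_derive z w (fun y : 'rV[R]_(n + m) => F (lsubmx y)) dF.
Proof.
case=> Fd FD.
have E : (fun h : R => h^-1 *: (((fun y : 'rV[R]_(n + m) => F (lsubmx y))
      \o shift z) (h *: w) - F (lsubmx z)))
    = (fun h : R => h^-1 *: ((F \o shift (lsubmx z)) (h *: lsubmx w)
      - F (lsubmx z))).
  by apply/funext => h /=; rewrite linearP.
by split; [rewrite /derivable E | rewrite -FD /derive E].
Qed.

Lemma is_derive_rsubmx (R : realType) (n m : nat) (z w : 'rV[R]_(n + m)) :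
  is_derive z w (fun y : 'rV[R]_(n + m) => rsubmx y) (rsubmx w).
Proof.
apply/is_derive_mxP => i j; rewrite mxE.
under eq_fun do rewrite mxE.
by move/is_derive_mxP: (is_derive_id z w); exact.
Qed.

Lemma diff_mx_comp (R : realType) (V V' : normedModType R) (m n : nat)
    (M : V' -> 'M[R]_(m, n)) (f : V -> V') x :
  differentiable f x -> diff_mx M (f x) -> diff_mx (fun y => M (f y)) x.
Proof.
by move=> fd Md i j; exact: differentiable_comp fd (Md i j).
Qed.

Section Sasaki.
Context {R : realType} {n : nat} {U : set 'rV[R]_n} {g : 'rV[R]_n -> 'M[R]_n}.
Hypothesis gU : metric_on U g.
Implicit Types (x u v w : 'rV[R]_n) (X Y : 'rV[R]_n -> 'rV[R]_n).
Implicit Types (z A B W : 'rV[R]_(n + n)).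

Lemma vpart_linear z a A B :
  vpart g z (a *: A + B) = a *: vpart g z A + vpart g z B.
Proof.
rewrite /vpart !linearP /= gammaDl gammaZl scalerDr.
by rewrite addrACA.
Qed.

Lemma inner_sasaki z A B : inner (sasaki g) z A B = sasaki_form g z A B.
Proof.
rewrite inner_bform; apply: bform_of_bilinear => [a P P' Q|a P Q Q'].
  rewrite /sasaki_form vpart_linear /hpart linearP /=.
  rewrite (innerDl _ _ (a *: lsubmx P)) (innerDl _ _ (a *: vpart g z P)).
  by rewrite !innerZl mulrDr addrACA.
rewrite /sasaki_form vpart_linear /hpart linearP /=.
rewrite (innerDr _ _ _ (a *: lsubmx Q)) (innerDr _ _ _ (a *: vpart g z Q)).
by rewrite !innerZr mulrDr addrACA.
Qed.

Lemma sasaki_sym z : U (lsubmx z) -> (sasaki g z)^T = sasaki g z.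
Proof.
move=> Uz; have form_sym A B : sasaki_form g z A B = sasaki_form g z B A.
  rewrite /sasaki_form (inner_sym gU (hpart A) (hpart B) Uz).
  by rewrite (inner_sym gU (vpart g z A) (vpart g z B) Uz).
apply/matrixP => i j; rewrite [LHS]mxE [LHS]mxE [RHS]mxE; exact: form_sym.
Qed.

Lemma sasaki_unit z : U (lsubmx z) -> sasaki g z \in unitmx.
Proof.
move=> Uz; apply: posdef_unitmx => W W0; rewrite -inner_bform inner_sasaki.
have inner_ge0 v : 0 <= inner g (lsubmx z) v v.
  have [->|v0] := eqVneq v 0; first by rewrite inner0l.
  exact/ltW/(metric_pos gU).
rewrite /sasaki_form; have [h0|h0] := eqVneq (hpart W) 0.
  apply: ltr_wpDl => //; apply: (metric_pos gU) => //.
  apply: contra_neq W0 => v0; rewrite (hv_decomp g z W) h0 v0.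
  by rewrite /hlift /vlift gamma0l oppr0 row_mx0 addr0.
by apply: ltr_pwDl => //; apply: (metric_pos gU).
Qed.

Lemma vpart_diff_mx z A : U (lsubmx z) -> diff_mx (fun y => vpart g y A) z.
Proof.
move=> Uz; apply: diff_mxD; first exact: diff_mx_cst.
move=> i k; rewrite ord1; under eq_fun do rewrite gamma_bform.
have ld := @differentiable_lsubmx R 1 n n z.
have rd : diff_mx (fun y : 'rV[R]_(n + n) => rsubmx y) z.
  move=> i' j; under eq_fun do rewrite mxE; exact: differentiable_coord.
exact: (diff_bform (diff_mx_comp ld (christoffel_diff_mx gU k Uz))
  (diff_mx_cst (lsubmx A) z) rd).
Qed.

Lemma sasaki_diff_mx z : U (lsubmx z) -> diff_mx (sasaki g) z.
Proof.
move=> Uz a b; under eq_fun do rewrite mxE /sasaki_form.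
have ld := @differentiable_lsubmx R 1 n n z.
have gd := diff_mx_comp ld (metric_diff_mx gU Uz).
apply: differentiableD.
  exact: (diff_bform gd (diff_mx_cst _ z) (diff_mx_cst _ z)).
exact: (diff_bform gd (vpart_diff_mx _ Uz) (vpart_diff_mx _ Uz)).
Qed.

(** The covariant derivative in the direction $W$ of the vertical part of the
    field with constant coordinates $A$. *)
Definition vpart_cov z W A : 'rV[R]_n :=
  dgamma g (lsubmx z) (lsubmx W) (lsubmx A) (rsubmx z)
  + gamma g (lsubmx z) (lsubmx A) (rsubmx W)
  + gamma g (lsubmx z) (lsubmx W) (vpart g z A).

Lemma is_derive_vpart z W A : U (lsubmx z) ->
  is_derive z W (fun y => vpart g y A)
    (dgamma g (lsubmx z) (lsubmx W) (lsubmx A) (rsubmx z)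
     + gamma g (lsubmx z) (lsubmx A) (rsubmx W)).
Proof.
move=> Uz; apply/is_derive_mxP => i k; rewrite ord1.
have -> : (fun y => vpart g y A 0 k) = (fun y => rsubmx A 0 k
    + bform (christoffel_mx g (lsubmx y) k) (lsubmx A) (rsubmx y)).
  by apply/funext => y; rewrite mxE gamma_bform.
have Cd := diff_mx_derivable (lsubmx W) (christoffel_diff_mx gU k Uz).
have H := is_derive_bform (is_derive_lsubmx Cd)
  (is_derive_cst (lsubmx A) z W) (is_derive_rsubmx z W).
apply: is_derive_eq (is_deriveD (is_derive_cst (rsubmx A 0 k) z W) H) _.
rewrite add0r [RHS]mxE -dgammaE -!gamma_bform.
by rewrite gamma0l [X in _ + X + _]mxE addr0.
Qed.

(** Both terms of the Sasaki metric are inner products for the metric of the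
    base, so that [derive_metric] makes their derivatives covariant. *)
Lemma dmetric_sasaki z W A B : U (lsubmx z) ->
  dmetric (sasaki g) z W A B
  = inner g (lsubmx z) (gamma g (lsubmx z) (lsubmx W) (lsubmx A)) (lsubmx B)
  + inner g (lsubmx z) (lsubmx A) (gamma g (lsubmx z) (lsubmx W) (lsubmx B))
  + inner g (lsubmx z) (vpart_cov z W A) (vpart g z B)
  + inner g (lsubmx z) (vpart g z A) (vpart_cov z W B).
Proof.
move=> Uz.
have gd := is_derive_lsubmx
  (diff_mx_derivable (lsubmx W) (metric_diff_mx gU Uz)).
have H1 := is_derive_bform gd (is_derive_cst (lsubmx A) z W)
  (is_derive_cst (lsubmx B) z W).
have H2 := is_derive_bform gd (is_derive_vpart W A Uz) (is_derive_vpart W B Uz).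
have [_ HS] := is_deriveD H1 H2.
have [_ HD] := is_derive_bform
  (diff_mx_derivable W (sasaki_diff_mx Uz)) (is_derive_cst A z W)
  (is_derive_cst B z W).
have E : (fun y => bform (sasaki g y) (cst A y) (cst B y))
  = (fun y : 'rV[R]_(n + n) => bform (g (lsubmx y)) (lsubmx A) (lsubmx B))
    + (fun y => bform (g (lsubmx y)) (vpart g y A) (vpart g y B)).
  by apply/funext => y; exact: inner_sasaki.
have dD u v : bform ('D_(lsubmx W) g (lsubmx z)) u v
    = inner g (lsubmx z) (gamma g (lsubmx z) (lsubmx W) u) v
      + inner g (lsubmx z) u (gamma g (lsubmx z) (lsubmx W) v).
  by rewrite -(derive_metric gU _ _ _ Uz) dmetric.unlock.
move: HD; rewrite E HS.
rewrite (inner0l (sasaki g) z _ : bform (sasaki g z) 0 (cst B z) = 0).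
rewrite (inner0r (sasaki g) z _ : bform (sasaki g z) (cst A z) 0 = 0).
rewrite (inner0l g _ _ : bform (g (lsubmx z)) 0 (cst (lsubmx B) z) = 0).
rewrite (inner0r g _ _ : bform (g (lsubmx z)) (cst (lsubmx A) z) 0 = 0).
rewrite !addr0 !dD => HD.
rewrite dmetric.unlock -[LHS]/(bform ('D_W (sasaki g) z) (cst A z) (cst B z)).
rewrite -{}HD -!inner_bform.
rewrite (innerDl _ _ _ (gamma g (lsubmx z) (lsubmx W) (vpart g z A))).
rewrite (innerDr _ _ _ _ (gamma g (lsubmx z) (lsubmx W) (vpart g z B))).
move: (inner g _ (_ + _) _) (inner g _ _ (_ + _)) => a b.
move: (inner g _ (gamma _ _ _ (lsubmx A)) _)
  (inner g _ _ (gamma _ _ _ (lsubmx B))) => c d.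
move: (inner g _ (gamma _ _ _ (vpart g z A)) _)
  (inner g _ _ (gamma _ _ _ (vpart g z B))) => e f.
ring.
Qed.

(** The vertical parts of coordinate fields fail to satisfy a symmetry of second
    derivatives by a curvature term: the horizontal distribution is not
    integrable when the base is curved. *)
Lemma vpart_cov_comm z W A : U (lsubmx z) ->
  vpart_cov z A W = vpart_cov z W A
    - curv g (lsubmx z) (lsubmx W) (lsubmx A) (rsubmx z).
Proof.
move=> Uz; rewrite /vpart_cov (curvE gU) // /vpart !gammaDr.
move: (dgamma g _ (lsubmx A) _ _) (dgamma g _ (lsubmx W) _ _) => a b.
move: (gamma g _ _ (rsubmx A)) (gamma g _ _ (rsubmx W)) => c d.
move: (gamma g _ (lsubmx A) (gamma _ _ _ _)).
move: (gamma g _ (lsubmx W) (gamma _ _ _ _)) => e f.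
by apply/rowP => k; rewrite !mxE; ring.
Qed.

(** The derivatives of the Sasaki metric in the Koszul formula involve
    [vpart_cov] with its arguments in both orders; exchanging them produces the
    three curvature terms. *)
Lemma gamma_sasaki z A B W : U (lsubmx z) ->
  let x := lsubmx z in
  inner (sasaki g) z (gamma (sasaki g) z A B) W
  = inner g x (gamma g x (lsubmx A) (lsubmx B)) (lsubmx W)
    + inner g x (vpart_cov z A B) (vpart g z W)
    + 2^-1 * (- inner g x (curv g x (lsubmx A) (lsubmx B) (rsubmx z))
                  (vpart g z W)
              + inner g x (curv g x (lsubmx A) (lsubmx W) (rsubmx z))
                  (vpart g z B)
              + inner g x (curv g x (lsubmx B) (lsubmx W) (rsubmx z))
                  (vpart g z A)).
Proof.
move=> Uz x.
rewrite (koszul _ _ _ (sasaki_diff_mx Uz) (sasaki_sym Uz) (sasaki_unit Uz)).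
rewrite !(dmetric_sasaki _ _ _ Uz) -/x.
rewrite (gammaC gU (lsubmx B) (lsubmx A) Uz).
rewrite (gammaC gU (lsubmx W) (lsubmx A) Uz).
rewrite (gammaC gU (lsubmx W) (lsubmx B) Uz).
rewrite (vpart_cov_comm A B Uz) (vpart_cov_comm A W Uz) (vpart_cov_comm B W Uz).
rewrite (inner_sym gU (lsubmx B) _ Uz) (inner_sym gU (vpart g z B) _ Uz) -/x.
move: (curv g x (lsubmx A) (lsubmx B) _ : 'rV[R]_n) => r1.
move: (curv g x (lsubmx A) (lsubmx W) _ : 'rV[R]_n) => r2.
move: (curv g x (lsubmx B) (lsubmx W) _ : 'rV[R]_n) => r3.
move: (vpart_cov z A B) (vpart_cov z A W) (vpart_cov z B W) => t1 t2 t3.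
move: (vpart g z A) (vpart g z B) (vpart g z W) => a b w.
move: (gamma g x (lsubmx A) (lsubmx B)) => c.
move: (gamma g x (lsubmx A) (lsubmx W)) => d.
move: (gamma g x (lsubmx B) (lsubmx W)) => e.
rewrite !innerDl !innerNl innerDr innerNr (inner_sym gU a r3 Uz).
move: (inner g x r1 w) (inner g x r2 b) => q1 q2.
move: (inner g x r3 a) (inner g x t1 w) => q3 q4.
by field.
Qed.

End Sasaki.

(** * Fields along a section of the tangent bundle *)

Section AlongSection.
Context {R : realType} {n : nat} {U : set 'rV[R]_n} {g : 'rV[R]_n -> 'M[R]_n}.
Hypothesis gU : metric_on U g.
Implicit Types (x u v w : 'rV[R]_n) (xi X Y : 'rV[R]_n -> 'rV[R]_n).

Definition hvlift g' (z : 'rV[R]_(n + n)) v w := hlift g' z v + vlift w.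

Lemma lsubmx_hvlift g' z v w : lsubmx (hvlift g' z v w) = v.
Proof. by rewrite /hvlift /hlift /vlift add_row_mx addr0 row_mxKl. Qed.

Lemma vpart_hvlift g' z v w : vpart g' z (hvlift g' z v w) = w.
Proof.
rewrite /vpart lsubmx_hvlift /hvlift /hlift /vlift add_row_mx row_mxKr.
by rewrite addrAC addNr add0r.
Qed.

(** The Levi-Civita connection of the Sasaki metric along a section, in
    invariant form: horizontal and vertical components are differentiated
    covariantly and corrected by the curvature of the base. The derivatives of
    the Christoffel symbols that come from the lifts cancel against those in [vpart_cov]. *)
Lemma cov_along_hvlift xi Y1 Y2 w1 w2 u x : U x ->
  derivable xi x u -> derivable Y1 x u -> derivable Y2 x u ->
  inner (sasaki g) (section xi x)
    (cov_along (sasaki g) (section xi) u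
       (fun y => hvlift g (section xi y) (Y1 y) (Y2 y)) x)
    (hvlift g (section xi x) w1 w2)
  = inner g x (cov g u Y1 x) w1 + inner g x (cov g u Y2 x) w2
    + 2^-1 * (- inner g x (curv g x u (Y1 x) (xi x)) w2
              + inner g x (curv g x u w1 (xi x)) (Y2 x)
              + inner g x (curv g x (Y1 x) w1 (xi x)) (cov g u xi x)).
Proof.
move=> Ux xid Y1d Y2d; set z := section xi x.
have zl : lsubmx z = x by rewrite row_mxKl.
have zr : rsubmx z = xi x by rewrite row_mxKr.
have Uz : U (lsubmx z) by rewrite zl.
have [_ Dz] := is_derive_row_mx (is_derive_id x u) (derivableP xid).
have DsE : 'D_u (section xi) x = row_mx u ('D_u xi x) by exact: Dz.
have [_ DY] := is_derive_row_mx (derivableP Y1d)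
  (is_deriveD (is_deriveN (is_derive_gamma gU Ux Y1d xid)) (derivableP Y2d)).
have liftE y : hvlift g (section xi y) (Y1 y) (Y2 y)
    = row_mx (Y1 y) (- gamma g y (Y1 y) (xi y) + Y2 y).
  by rewrite /hvlift /hlift /vlift /section add_row_mx addr0 row_mxKl row_mxKr.
have YE : (fun y => hvlift g (section xi y) (Y1 y) (Y2 y))
    = (fun y => row_mx (Y1 y)
        (((- (fun y => gamma g y (Y1 y) (xi y))) + Y2) y)).
  by apply/funext => y; exact: liftE.
rewrite /cov_along {1}YE DY DsE -/z.
rewrite innerDl inner_sasaki (gamma_sasaki gU _ _ _ Uz) /sasaki_form /hpart.
rewrite !lsubmx_hvlift !vpart_hvlift !row_mxKl /vpart_cov zl zr vpart_hvlift.
rewrite lsubmx_hvlift !row_mxKl !row_mxKr /vpart !row_mxKl !row_mxKr.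
rewrite /cov; move: (2^-1 * _) => S.
move: (dgamma g _ _ _ _) (gamma g x ('D_u Y1 x) _) (gamma g x _ ('D_u xi x)).
move: (gamma g x u (Y1 x)) (gamma g x u (Y2 x)) => a b c d e.
move: ('D_u Y1 x) ('D_u Y2 x) => p q.
rewrite !innerDl innerNl !innerDl.
move: (inner g x p _) (inner g x q _) (inner g x a _) => p' q' a'.
move: (inner g x b _) (inner g x c _) (inner g x d _) => b' c' d'.
move: (inner g x e _) => e'.
ring.
Qed.

End AlongSection.

(** * Moving frames *)

Section Frames.
Context {R : realType} {n : nat} {U : set 'rV[R]_n} {g : 'rV[R]_n -> 'M[R]_n}.
Hypothesis gU : metric_on U g.
Implicit Types (x u v w : 'rV[R]_n) (X Y : 'rV[R]_n -> 'rV[R]_n).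

Lemma C1_derivable X x w : Ck U 1 X -> U x -> derivable X x w.
Proof.
by move=> X1 Ux; have [] := diff_mx_derivable w (Ck1_diff_mx gU X1 Ux).
Qed.

Lemma cov_linear X x a u v : Ck U 1 X -> U x ->
  cov g (a *: u + v) X x = a *: cov g u X x + cov g v X x.
Proof.
move=> X1 Ux; rewrite /cov (diff_mx_linear _ _ _ (Ck1_diff_mx gU X1 Ux)).
rewrite gammaDl gammaZl scalerDr.
move: (_ *: 'D_u X x) ('D_v X x) => p q; exact: addrACA.
Qed.

Lemma covZ X x a u : Ck U 1 X -> U x -> cov g (a *: u) X x = a *: cov g u X x.
Proof.
move=> X1 Ux; rewrite -[in LHS](addr0 (a *: u)) (cov_linear _ _ _ X1 Ux).
by rewrite {2}/cov derive0 gamma0l !addr0.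
Qed.

Lemma cov_scale (f : 'rV[R]_n -> R) X x w :
  derivable f x w -> derivable X x w ->
  cov g w (fun y => f y *: X y) x = 'D_w f x *: X x + f x *: cov g w X x.
Proof.
move=> fd Xd; rewrite {1}/cov.
have [_ ->] := is_derive_scale (derivableP fd) (derivableP Xd).
by rewrite gammaZr -addrA -scalerDr.
Qed.

Lemma cov_cst0 x w : cov g w (fun=> 0) x = 0.
Proof. by rewrite /cov derive_cst gamma0r addr0. Qed.

Lemma inner_cov_const X Y (c : R) x w : U x ->
  derivable X x w -> derivable Y x w ->
  (forall y, U y -> inner g y (X y) (Y y) = c) ->
  inner g x (cov g w X x) (Y x) + inner g x (X x) (cov g w Y x) = 0.
Proof.
move=> Ux Xd Yd XY; have [_ <-] := is_derive_inner gU Ux Xd Yd.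
rewrite -[RHS](derive_cst c x w); apply: near_eq_derive.
by apply: filterS (near_dom gU Ux) => y /XY.
Qed.

(** If $\nabla X = \omega \otimes Y$ and $\nabla Y = -\omega \otimes X$, then
    the quadratic terms of the curvature cancel and only $d\omega$ remains. *)
Lemma curv_rotation X Y (omega : 'rV[R]_n -> 'rV[R]_n -> R) x u v :
  Ck U 2 X -> Ck U 2 Y -> U x ->
  (forall y w, U y -> cov g w X y = omega y w *: Y y) ->
  (forall y w, U y -> cov g w Y y = - omega y w *: X y) ->
  derivable (fun y => omega y v) x u -> derivable (fun y => omega y u) x v ->
  curv g x u v (X x)
  = ('D_u (fun y => omega y v) x - 'D_v (fun y => omega y u) x) *: Y x.
Proof.
move=> X2 Y2 Ux dX dY ov ou; rewrite -(cov_comm gU _ _ X2 Ux).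
have covcov a b : derivable (fun y => omega y b) x a ->
    cov g a (fun y => cov g b X y) x
    = 'D_a (fun y => omega y b) x *: Y x - (omega x b * omega x a) *: X x.
  move=> oba; have Yd := C1_derivable (w := a) (Ck_weaken Y2) Ux.
  have E : 'D_a (fun y => cov g b X y) x = 'D_a (fun y => omega y b *: Y y) x.
    by apply: near_eq_derive; apply: filterS (near_dom gU Ux) => y; exact: dX.
  have -> : cov g a (fun y => cov g b X y) x
      = cov g a (fun y => omega y b *: Y y) x.
    by rewrite {1}/cov E dX.
  by rewrite (cov_scale oba Yd) dY// scalerA mulrN scaleNr.
rewrite (covcov u v ov) (covcov v u ou) scalerBl.
by rewrite [omega x u * _]mulrC opprB addrA subrK.
Qed.

End Frames.

Section PlaneFrames.
Context {R : realType}.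
Implicit Types (g : 'rV[R]_2 -> 'M[R]_2) (x u v w a b X Y E F : 'rV[R]_2).

Definition orthonormal_at g x a b : Prop :=
  [/\ inner g x a a = 1, inner g x b b = 1 & inner g x a b = 0].

Lemma det_mx2 (M : 'M[R]_2) : \det M = M 0 0 * M 1 1 - M 0 1 * M 1 0.
Proof.
rewrite (expand_det_row _ 0) !big_ord_recl big_ord0 /cofactor !det_mx11 addr0.
have minor j : row' 0 (col' j M) 0 0 = M (lift 0 0) (lift j 0).
  by rewrite [LHS]mxE [LHS]mxE.
rewrite !minor /= expr0 mul1r expr1 mulN1r mulrN.
by congr (M _ _ * M _ _ - M _ _ * M _ _); exact: val_inj.
Qed.

Lemma det_col_mx u v :
  \det (col_mx u v : 'M[R]_2) = u 0 0 * v 0 1 - u 0 1 * v 0 0.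
Proof.
have E0 j : (col_mx u v : 'M[R]_2) 0 j = u 0 j.
  by have := col_mxEu u v 0 j; rewrite (_ : lshift 1 0 = 0)//; apply: val_inj.
have E1 j : (col_mx u v : 'M[R]_2) 1 j = v 0 j.
  by have := col_mxEd u v 0 j; rewrite (_ : rshift 1 0 = 1)//; apply: val_inj.
by rewrite det_mx2 !E0 !E1.
Qed.

Lemma inner2E g x u v : (g x)^T = g x ->
  inner g x u v = u 0 0 * v 0 0 * g x 0 0
    + (u 0 0 * v 0 1 + u 0 1 * v 0 0) * g x 0 1 + u 0 1 * v 0 1 * g x 1 1.
Proof.
move=> gs; have g10 : g x 1 0 = g x 0 1 by rewrite -{1}gs mxE.
rewrite inner_bform bformE !big_ord_recl !big_ord0 /=.
rewrite (_ : lift ord0 ord0 = 1); last exact: val_inj.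
by rewrite g10; ring.
Qed.

End PlaneFrames.

(** * Gaussian curvature and orthonormal frames *)

Section PlaneCurvature.
Context {R : realType} {U : set 'rV[R]_2} {g : 'rV[R]_2 -> 'M[R]_2}.
Hypothesis gU : metric_on U g.
Implicit Types (x u v w a b X Y E F : 'rV[R]_2).

Lemma gram_det x u v : U x ->
  inner g x u u * inner g x v v - inner g x u v ^+ 2
  = \det (col_mx u v : 'M[R]_2) ^+ 2 * (g x 0 0 * g x 1 1 - g x 0 1 ^+ 2).
Proof.
by move=> Ux; rewrite !(inner2E _ _ (metric_sym gU Ux)) det_col_mx; ring.
Qed.

Lemma orthonormal_det x a b : U x -> orthonormal_at g x a b ->
  \det (col_mx a b : 'M[R]_2) ^+ 2 * (g x 0 0 * g x 1 1 - g x 0 1 ^+ 2) = 1.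
Proof.
by move=> Ux [aa bb ab]; rewrite -gram_det// aa bb ab expr0n subr0 mulr1.
Qed.

Lemma rV2P u v : u 0 0 = v 0 0 -> u 0 1 = v 0 1 -> u = v.
Proof.
move=> e0 e1; apply/rowP => i.
by case: (unliftP 0 i) => [j ->|-> //]; rewrite ord1 (_ : lift 0 0 = 1)//;
  exact: val_inj.
Qed.

Lemma orthonormal_expand x a b v : U x -> orthonormal_at g x a b ->
  v = inner g x v a *: a + inner g x v b *: b.
Proof.
move=> Ux ab; have [aa bb ab0] := ab; have := orthonormal_det Ux ab.
rewrite det_col_mx; set d := _ - _ => dg.
have d0 : d != 0.
  by apply: contra_eq_neq dg => ->; rewrite expr0n mul0r eq_sym oner_neq0.
(* Cramer's rule. *)
have vE : v = ((v 0 0 * b 0 1 - v 0 1 * b 0 0) / d) *: a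
    + ((a 0 0 * v 0 1 - a 0 1 * v 0 0) / d) *: b.
  by apply: rV2P; rewrite !mxE; move: d0; rewrite /d => d0; field.
move: (_ / d) (_ / d) vE => p q ->.
rewrite !innerDl !innerZl aa bb ab0 (inner_sym gU b a Ux) ab0.
by rewrite !mulr0 !mulr1 addr0 add0r.
Qed.

Lemma curv_basis x E F w : U x ->
  curv g x E F w
  = \det (col_mx E F : 'M[R]_2) *: curv g x (basis_vec 0) (basis_vec 1) w.
Proof.
move=> Ux; have bE v : v = v 0 0 *: basis_vec 0 + v 0 1 *: basis_vec 1.
  by apply: rV2P; rewrite !mxE /= ?mulr1 ?mulr0 ?addr0 ?add0r.
rewrite {1}(bE E) (curv_linear1 gU _ _ _ _ _ Ux) (curvZl gU _ _ _ _ Ux).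
rewrite {1 2}(bE F) !(curv_linear2 gU _ _ _ _ _ Ux) !(curvZr gU _ _ _ _ Ux).
rewrite !curv_same.
rewrite (curv_antisym _ (basis_vec 0) (basis_vec 1)) det_col_mx.
move: (curv _ _ _ _ _) => r; apply/rowP => k; rewrite !mxE; ring.
Qed.

(** On the frame $(X, Y)$ the curvature operator $R(E, F)$ is an infinitesimal
    rotation with speed $\rho$. Passing to the coordinate frame in both places
    multiplies $\rho$ by the quotient of the determinants of the two frames,
    which is 1 or -1 according to their relative orientation. *)
Lemma gauss_curv_frames x X Y E F (rho : R) : U x ->
  orthonormal_at g x X Y -> orthonormal_at g x E F ->
  curv g x E F X = rho *: Y -> curv g x E F Y = - rho *: X ->
  (-1) ^+ ((if 0 < \det (col_mx X Y *m invmx (col_mx E F) : 'M[R]_2)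
            then 1%N else 0%N) + 1) * gauss_curv g x = - rho.
Proof.
move=> Ux XY EF; rewrite (curv_basis E F X Ux) (curv_basis E F Y Ux).
have dX := orthonormal_det Ux XY; have dE := orthonormal_det Ux EF.
rewrite /gauss_curv gram_det// det_mulmx det_inv.
set a := basis_vec 0; set b := basis_vec 1.
have ab1 : \det (col_mx a b : 'M[R]_2) = 1.
  by rewrite det_col_mx !mxE /= mulr1 mulr0 subr0.
rewrite ab1 expr1n mul1r; set r := curv g x a b => rX rY.
have r_lin c v w : r (c *: v + w) = c *: r v + r w.
  exact: (curv_linear3 gU _ _ _ _ _ Ux).
have r0 : r 0 = 0.
  have := r_lin 1 0 0; rewrite scaler0 addr0 scale1r => /eqP.
  by rewrite -subr_eq subrr eq_sym => /eqP.
have rZ c v : r (c *: v) = c *: r v by rewrite -[c *: v]addr0 r_lin r0 addr0.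
have rb : r b = inner g x b X *: r X + inner g x b Y *: r Y.
  by rewrite {1}(orthonormal_expand b Ux XY) r_lin rZ.
move: dX dE rX rY; set p := \det _; set q := \det _; set G := _ - _ => dX dE.
have q0 : q != 0.
  by apply: contra_eq_neq dE => ->; rewrite expr0n mul0r eq_sym oner_neq0.
have G0 : G != 0.
  by apply: contra_eq_neq dE => ->; rewrite mulr0 eq_sym oner_neq0.
move=> rX rY.
have {}rX : r X = (rho / q) *: Y.
  by rewrite mulrC -scalerA -rX scalerA mulVf// scale1r.
have {}rY : r Y = - (rho / q) *: X.
  by rewrite -mulNr mulrC -scalerA -rY scalerA mulVf// scale1r.
have cross : inner g x b X * inner g x Y a - inner g x b Y * inner g x X a
    = - (p * G).
  rewrite !(inner2E _ _ (metric_sym gU Ux)) /p /G det_col_mx !mxE /=; ring.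
have K : inner g x (r b) a = - (rho * (p / q)) * G.
  rewrite rb rX rY innerDl !innerZl.
  have -> : - (rho * (p / q)) * G = rho / q * - (p * G) by ring.
  by rewrite -cross; ring.
rewrite K mulfK//.
have : (p == q) || (p == - q).
  by rewrite -eqf_sqr; apply/eqP/(mulIf G0); rewrite dX dE.
case/orP => /eqP ->; first by rewrite divff// ltr01 mulr1 sqrrN expr1n mul1r.
by rewrite mulNr divff// ltr0N1 expr1 mulrN1 opprK mulN1r.
Qed.

End PlaneCurvature.

(** * The submanifold defined by a unit vector field *)

Section UnitField.
Context {R : realType} {U : set 'rV[R]_2} {g : 'rV[R]_2 -> 'M[R]_2}.
Hypothesis gU : metric_on U g.
Context {xi eta e0 e1 : 'rV[R]_2 -> 'rV[R]_2} {lam mu sigma : 'rV[R]_2 -> R}.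
Hypothesis xi2 : Ck U 2 xi.
Hypothesis eta2 : Ck U 2 eta.
Hypothesis e02 : Ck U 2 e0.
Hypothesis e12 : Ck U 2 e1.
Hypothesis xi_eta : forall y, U y -> orthonormal_at g y (xi y) (eta y).
Hypothesis e0_e1 : forall y, U y -> orthonormal_at g y (e0 y) (e1 y).
Hypothesis cov_e0_xi : forall y, U y -> cov g (e0 y) xi y = 0.
Hypothesis cov_e1_xi : forall y, U y -> cov g (e1 y) xi y = lam y *: eta y.
Hypothesis cov_e0_e0 : forall y, U y -> cov g (e0 y) e0 y = mu y *: e1 y.
Hypothesis cov_e1_e1 : forall y, U y -> cov g (e1 y) e1 y = sigma y *: e0 y.
Implicit Types (x y v w : 'rV[R]_2).

(** The connection form of the frame $(\xi, \eta)$. *)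
Definition connection_form y w : R := lam y * inner g y w (e1 y).

Lemma cov_xi y w : U y -> cov g w xi y = connection_form y w *: eta y.
Proof.
move=> Uy; have xi1 := Ck_weaken xi2.
rewrite {1}(orthonormal_expand gU w Uy (e0_e1 Uy)) (cov_linear gU _ _ _ xi1 Uy).
rewrite (covZ gU _ _ xi1 Uy) cov_e0_xi// cov_e1_xi// scaler0 add0r scalerA.
by rewrite mulrC.
Qed.

(** The frame is orthonormal, so that $\nabla\eta$ is determined by
    $\nabla\xi$. *)
Lemma cov_eta y w : U y -> cov g w eta y = - connection_form y w *: xi y.
Proof.
move=> Uy; have xid := C1_derivable (w := w) gU (Ck_weaken xi2) Uy.
have etad := C1_derivable (w := w) gU (Ck_weaken eta2) Uy.
have [xx ee xe] := xi_eta Uy.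
have := inner_cov_const gU Uy etad etad
  (fun z Uz => let: And3 _ h _ := xi_eta Uz in h).
have := inner_cov_const gU Uy xid etad
  (fun z Uz => let: And3 _ _ h := xi_eta Uz in h).
rewrite (cov_xi _ Uy); move: (cov g w eta y) => c.
rewrite innerZl ee mulr1 (inner_sym gU (xi y) c Uy) (inner_sym gU (eta y) c Uy).
move=> /eqP; rewrite addrC addr_eq0 => /eqP cx /eqP.
rewrite -mulr2n mulrn_eq0 /= => /eqP ce.
by rewrite {1}(orthonormal_expand gU c Uy (xi_eta Uy)) cx ce scale0r addr0.
Qed.

(** The equality $\lambda = \langle\nabla_{e_1}\xi, \eta\rangle$ expresses
    $\lambda$ by differentiable functions. *)
Lemma lam_differentiable y : U y -> differentiable lam y.
Proof.
move=> Uy; have [_ xiC] := xi2.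
pose J z : 'M[R]_2 := \matrix_(k, j) ('D_(basis_vec k) xi z) 0 j.
have Jd : diff_mx J y.
  move=> k j; under eq_fun do rewrite mxE.
  have [_ xi1] := xiC (basis_vec k).
  exact: (Ck1_diff_mx gU xi1 Uy 0 j).
pose G z : 'rV[R]_2 := \row_k bform (christoffel_mx g z k) (e1 z) (xi z).
have diff1 (X : 'rV[R]_2 -> 'rV[R]_2) : Ck U 2 X -> diff_mx X y.
  by move=> X2; exact: (Ck1_diff_mx gU (Ck_weaken X2) Uy).
have Gd : diff_mx G y.
  move=> i k; under eq_fun do rewrite mxE.
  exact: (diff_bform (christoffel_diff_mx gU k Uy) (diff1 _ e12) (diff1 _ xi2)).
have covE z : U z -> cov g (e1 z) xi z = e1 z *m J z + G z.
  move=> Uz; rewrite /cov.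
  rewrite (diff_mx_sum_delta (e1 z) (Ck1_diff_mx gU (Ck_weaken xi2) Uz)).
  congr (_ + _); last by apply/rowP => k; rewrite gamma_bform [RHS]mxE.
  apply/rowP => j; rewrite summxE [RHS]mxE; apply: eq_bigr => k _.
  by rewrite [LHS]mxE [J z k j]mxE.
apply: (@near_eq_differentiable _ _ _
  (fun z => bform (g z) (e1 z *m J z + G z) (eta z))).
  apply: filterS (near_dom gU Uy) => z Uz.
  rewrite -covE// cov_e1_xi// bformZl -inner_bform.
  by have [_ -> _] := xi_eta Uz; rewrite mulr1.
exact: (diff_bform (metric_diff_mx gU Uy)
  (diff_mxD (diff_mxM (diff1 _ e12) Jd) Gd) (diff1 _ eta2)).
Qed.

Lemma is_derive_connection_form y v w : U y ->
  is_derive y w (fun z => connection_form z v)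
    (lam y * (inner g y (gamma g y w v) (e1 y) + inner g y v (cov g w e1 y))
     + inner g y v (e1 y) * 'D_w lam y).
Proof.
move=> Uy; have e1d := C1_derivable (w := w) gU (Ck_weaken e12) Uy.
have H := is_derive_inner gU Uy (derivable_cst v y w) e1d.
have ld := derivableP (diff_derivable (v := w) (lam_differentiable Uy)).
apply: is_derive_eq (is_deriveM ld H) _.
by rewrite {1}/cov derive_cst add0r.
Qed.

(** The value $d\omega(e_0, e_1)$ for the connection form $\omega$. *)
Definition curvature_form x : R := 'D_(e0 x) lam x - sigma x * lam x.

Lemma connection_form_d x : U x ->
  'D_(e0 x) (fun z => connection_form z (e1 x)) x
  - 'D_(e1 x) (fun z => connection_form z (e0 x)) x = curvature_form x.
Proof.
move=> Ux; have [_ ->] := is_derive_connection_form (e1 x) (e0 x) Ux.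
have [_ ->] := is_derive_connection_form (e0 x) (e1 x) Ux.
have [ee ff ef] := e0_e1 Ux.
have e1d := C1_derivable (w := e0 x) gU (Ck_weaken e12) Ux.
have := inner_cov_const gU Ux e1d e1d
  (fun z Uz => let: And3 _ h _ := e0_e1 Uz in h).
rewrite (inner_sym gU (cov g (e0 x) e1 x) _ Ux) -mulr2n => /eqP.
rewrite mulrn_eq0 /= => /eqP ->.
rewrite cov_e1_e1// innerZr ee ff ef (gammaC gU (e1 x) (e0 x) Ux).
by rewrite /curvature_form; move: ('D_(e0 x) lam x) => d; ring.
Qed.

Lemma curv_xi x : U x ->
  curv g x (e0 x) (e1 x) (xi x) = curvature_form x *: eta x.
Proof.
move=> Ux; rewrite -connection_form_d//.
apply: (curv_rotation gU xi2 eta2 Ux) => [y w|y w||]; first exact: cov_xi.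
- exact: cov_eta.
- by have [] := is_derive_connection_form (e1 x) (e0 x) Ux.
- by have [] := is_derive_connection_form (e0 x) (e1 x) Ux.
Qed.

Lemma curv_eta x : U x ->
  curv g x (e0 x) (e1 x) (eta x) = - curvature_form x *: xi x.
Proof.
move=> Ux.
have [d1 D1] := is_deriveN (is_derive_connection_form (e1 x) (e0 x) Ux).
have [d0 D0] := is_deriveN (is_derive_connection_form (e0 x) (e1 x) Ux).
have [_ E1] := is_derive_connection_form (e1 x) (e0 x) Ux.
have [_ E0] := is_derive_connection_form (e0 x) (e1 x) Ux.
rewrite (curv_rotation (omega := fun y w => - connection_form y w)
  gU eta2 xi2 Ux _ _ d1 d0) => [|y w|y w].
- by rewrite D1 D0 -E1 -E0 -opprD connection_form_d.
- exact: cov_eta.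
- by rewrite opprK; exact: cov_xi.
Qed.

(** With $\lambda = \tan\theta$, the frame vector $\tilde e_1$ is
    $\cos\theta\, e_1^h + \sin\theta\, \eta^v$. *)
Definition tilt_cos y : R := (Num.sqrt (1 + lam y ^+ 2))^-1.

Lemma tilt_cos_sq y : tilt_cos y * tilt_cos y * (1 + lam y * lam y) = 1.
Proof.
have pos : 0 < 1 + lam y ^+ 2 by rewrite ltr_pwDl// sqr_ge0.
rewrite /tilt_cos -expr2 exprVn sqr_sqrtr ?ltW// -expr2 mulVf//.
by rewrite gt_eqF.
Qed.

Lemma tilt_cos_differentiable y : U y -> differentiable tilt_cos y.
Proof.
move=> Uy; have ld := lam_differentiable Uy.
have pos : 0 < 1 + lam y * lam y by rewrite ltr_pwDl// -expr2 sqr_ge0.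
have sd : differentiable (fun z => Num.sqrt (1 + lam z * lam z)) y.
  apply: (@differentiable_comp _ _ _ _ (fun z => 1 + lam z * lam z) Num.sqrt).
    by apply: differentiableD => //; exact: differentiableM.
  by apply/derivable1_diffP; have [] := is_derive1_sqrt pos.
apply: differentiableV => //.
by rewrite gt_eqF// sqrtr_gt0.
Qed.

Lemma derive_tilt_cos y w : U y ->
  'D_w tilt_cos y = - tilt_cos y ^+ 3 * (lam y * 'D_w lam y).
Proof.
move=> Uy.
have ld := derivableP (diff_derivable (v := w) (lam_differentiable Uy)).
have nd := derivableP (diff_derivable (v := w) (tilt_cos_differentiable Uy)).
have [_] := is_deriveM (is_deriveM nd nd)
  (is_deriveD (is_derive_cst (1 : R) y w) (is_deriveM ld ld)).
have -> : tilt_cos * tilt_cos * (cst 1 + lam * lam) = cst 1.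
  by apply/funext => z; exact: tilt_cos_sq.
rewrite derive_cst add0r => E.
have {E} : 0 = tilt_cos y * tilt_cos y * (lam y * 'D_w lam y
      + lam y * 'D_w lam y)
    + (1 + lam y * lam y) * (tilt_cos y * 'D_w tilt_cos y
      + tilt_cos y * 'D_w tilt_cos y) by exact: E.
move: (tilt_cos_sq y) ('D_w lam y) ('D_w tilt_cos y).
move: (tilt_cos y) (lam y) => a l al dl da E.
have E2 : (1 + l * l) * a * da = - (a * a * l * dl) by lra.
have -> : da = a * ((1 + l * l) * a * da).
  by rewrite -{1}[da]mul1r -{1}al; ring.
rewrite E2; ring.
Qed.

Definition tilt_sin y : R := lam y * tilt_cos y.

Lemma derive_tilt_sin y w : U y ->
  'D_w tilt_sin y = lam y * 'D_w tilt_cos y + tilt_cos y * 'D_w lam y.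
Proof.
move=> Uy.
have ld := diff_derivable (v := w) (lam_differentiable Uy).
have nd := diff_derivable (v := w) (tilt_cos_differentiable Uy).
exact: deriveM ld nd.
Qed.

Lemma tilt_sin_differentiable y : U y -> differentiable tilt_sin y.
Proof.
move=> Uy; apply: differentiableM; first exact: lam_differentiable.
exact: tilt_cos_differentiable.
Qed.

Let hvlift0 z v : hvlift g z v 0 = hlift g z v.
Proof. by rewrite /hvlift /vlift row_mx0 addr0. Qed.

Let scale_hvlift z a v w : a *: hvlift g z v w = hvlift g z (a *: v) (a *: w).
Proof.
rewrite /hvlift /hlift /vlift !add_row_mx !addr0 scale_row_mx.
by rewrite scalerDr scalerN -gammaZl.
Qed.

Lemma etildeE (i : 'I_2) : etilde g xi eta e0 e1 lam i
  = if i == 0 then fun y => hvlift g (section xi y) (e0 y) 0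
    else fun y => hvlift g (section xi y) (tilt_cos y *: e1 y)
                    (tilt_sin y *: eta y).
Proof.
apply/funext => y; rewrite /etilde; case: (i == 0); first by rewrite hvlift0.
rewrite -[hlift g (section xi y) (e1 y)]hvlift0.
have -> : hvlift g (section xi y) (e1 y) 0 + lam y *: vlift (eta y)
    = hvlift g (section xi y) (e1 y) (lam y *: eta y).
  by rewrite /hvlift /vlift row_mx0 addr0 scale_row_mx scaler0.
by rewrite scale_hvlift scalerA mulrC.
Qed.

Lemma ntildeE y : ntilde g xi eta e1 lam y
  = hvlift g (section xi y) (- tilt_sin y *: e1 y) (tilt_cos y *: eta y).
Proof.
rewrite /ntilde.
have -> : - lam y *: hlift g (section xi y) (e1 y) + vlift (eta y)
    = hvlift g (section xi y) (- lam y *: e1 y) (eta y).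
  by rewrite -hvlift0 scale_hvlift scaler0 hvlift0.
by rewrite scale_hvlift scalerA mulrN mulrC.
Qed.

Lemma hpart_etilde (i : 'I_2) y : hpart (etilde g xi eta e0 e1 lam i y)
  = if i == 0 then e0 y else tilt_cos y *: e1 y.
Proof. by rewrite etildeE /hpart; case: (i == 0); rewrite lsubmx_hvlift. Qed.

Section AtPoint.
Variable x : 'rV[R]_2.
Hypothesis Ux : U x.

Let C2_derivable (X : 'rV[R]_2 -> 'rV[R]_2) w : Ck U 2 X -> derivable X x w.
Proof. by move=> X2; exact: (C1_derivable gU (Ck_weaken X2) Ux). Qed.

Let inner_e1_cov w : inner g x (cov g w e1 x) (e1 x) = 0.
Proof.
have ed := C2_derivable (w := w) e12.
have := inner_cov_const gU Ux ed ed
  (fun z Uz => let: And3 _ h _ := e0_e1 Uz in h).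
rewrite (inner_sym gU (e1 x) _ Ux) -mulr2n => /eqP.
by rewrite mulrn_eq0 /= => /eqP.
Qed.

Let inner_cov_e1_e0 : inner g x (cov g (e1 x) e0 x) (e1 x) = - sigma x.
Proof.
have := inner_cov_const gU Ux
  (C2_derivable (w := e1 x) e02) (C2_derivable (w := e1 x) e12)
  (fun z Uz => let: And3 _ _ h := e0_e1 Uz in h).
have [ee _ _] := e0_e1 Ux.
by rewrite cov_e1_e1// innerZr ee mulr1 => /eqP; rewrite addr_eq0 => /eqP.
Qed.

Let inner_cov_scale_e1 (f : 'rV[R]_2 -> R) w : differentiable f x ->
  inner g x (cov g w (fun y => f y *: e1 y) x) (e1 x) = 'D_w f x.
Proof.
move=> df; have [_ ff _] := e0_e1 Ux.
rewrite (cov_scale (diff_derivable (v := w) df) (C2_derivable (w := w) e12)).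
by rewrite innerDl !innerZl ff inner_e1_cov mulr1 mulr0 addr0.
Qed.

Let inner_cov_scale_eta (f : 'rV[R]_2 -> R) w : differentiable f x ->
  inner g x (cov g w (fun y => f y *: eta y) x) (eta x) = 'D_w f x.
Proof.
move=> df; have [_ ee xe] := xi_eta Ux.
rewrite (cov_scale (diff_derivable (v := w) df) (C2_derivable (w := w) eta2)).
by rewrite cov_eta// innerDl !innerZl ee xe !mulr0 mulr1 addr0.
Qed.

Let curv_e0_e1 : curv g x (e0 x) (e1 x) (xi x) = curvature_form x *: eta x.
Proof. exact: curv_xi. Qed.

Let curv_e1_e0 : curv g x (e1 x) (e0 x) (xi x) = - curvature_form x *: eta x.
Proof. by rewrite curv_antisym curv_e0_e1 scaleNr. Qed.

Let a := tilt_cos x.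
Let h := tilt_sin x.
Let rho := curvature_form x.
Let nd : differentiable tilt_cos x := tilt_cos_differentiable Ux.
Let hd : differentiable tilt_sin x := tilt_sin_differentiable Ux.

Let sff (u : 'rV[R]_2) Y1 Y2 : R :=
  inner (sasaki g) (section xi x)
    (cov_along (sasaki g) (section xi) u
       (fun y => hvlift g (section xi y) (Y1 y) (Y2 y)) x)
    (hvlift g (section xi x) (- h *: e1 x) (a *: eta x)).

Let ae1_d w : derivable (fun y => tilt_cos y *: e1 y) x w.
Proof.
have fd := derivableP (diff_derivable (v := w) nd).
by have [] := is_derive_scale fd (derivableP (C2_derivable (w := w) e12)).
Qed.

Let heta_d w : derivable (fun y => tilt_sin y *: eta y) x w.
Proof.
have fd := derivableP (diff_derivable (v := w) hd).
by have [] := is_derive_scale fd (derivableP (C2_derivable (w := w) eta2)).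
Qed.

Let sffE u Y1 Y2 : derivable Y1 x u -> derivable Y2 x u ->
  sff u Y1 Y2 = - h * inner g x (cov g u Y1 x) (e1 x)
    + a * inner g x (cov g u Y2 x) (eta x)
    + 2^-1 * (- (a * inner g x (curv g x u (Y1 x) (xi x)) (eta x))
       - h * inner g x (curv g x u (e1 x) (xi x)) (Y2 x)
       - h * inner g x (curv g x (Y1 x) (e1 x) (xi x)) (cov g u xi x)).
Proof.
move=> Y1d Y2d; have xid := C2_derivable (w := u) xi2.
rewrite /sff (cov_along_hvlift gU _ _ Ux xid Y1d Y2d).
by rewrite !innerZr !(curvZr gU _ _ _ _ Ux) !innerZl !mulNr.
Qed.

Let sff00 : sff (e0 x) e0 (fun=> 0) = - mu x * h.
Proof.
have [ee ff ef] := e0_e1 Ux.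
rewrite sffE; [|exact: C2_derivable|exact: derivable_cst].
rewrite cov_e0_e0// cov_e0_xi// cov_cst0 curv_same !inner0r !inner0l.
by rewrite innerZl ff; ring.
Qed.

Let sff01 : sff (e0 x) (fun y => tilt_cos y *: e1 y)
    (fun y => tilt_sin y *: eta y)
  = - h * 'D_(e0 x) tilt_cos x + a * 'D_(e0 x) tilt_sin x
    - 2^-1 * (rho * (a * a + h * h)).
Proof.
have [_ ee _] := xi_eta Ux.
rewrite sffE; [|exact: ae1_d|exact: heta_d].
rewrite inner_cov_scale_e1// inner_cov_scale_eta// cov_e0_xi// inner0r.
rewrite !(curvZr gU _ _ _ _ Ux) curv_e0_e1 !innerZl innerZr ee.
rewrite -/a -/h -/rho.
move: ('D_(e0 x) tilt_cos x) ('D_(e0 x) tilt_sin x) => p q.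
by ring.
Qed.

Let sff10 : sff (a *: e1 x) e0 (fun=> 0)
  = a * h * sigma x + 2^-1 * (rho * (a * a - h * a * lam x)).
Proof.
have [_ ee _] := xi_eta Ux.
have e01 := Ck_weaken e02; have xi1 := Ck_weaken xi2.
rewrite sffE; [|exact: C2_derivable|exact: derivable_cst].
rewrite (covZ gU _ _ e01 Ux) (covZ gU _ _ xi1 Ux) cov_e1_xi// cov_cst0.
rewrite (curvZl gU _ _ _ _ Ux) curv_e1_e0 curv_e0_e1 inner0l inner0r.
rewrite !innerZl !innerZr inner_cov_e1_e0 ee -/rho.
by ring.
Qed.

Let sff11 : sff (a *: e1 x) (fun y => tilt_cos y *: e1 y)
    (fun y => tilt_sin y *: eta y)
  = - h * 'D_(a *: e1 x) tilt_cos x + a * 'D_(a *: e1 x) tilt_sin x.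
Proof.
rewrite sffE; [|exact: ae1_d|exact: heta_d].
rewrite inner_cov_scale_e1// inner_cov_scale_eta//.
rewrite !(curvZl gU _ _ _ _ Ux) !(curvZr gU _ _ _ _ Ux).
by rewrite !curv_same !scaler0 !inner0l !mulr0 oppr0 !addr0 !mulr0 addr0.
Qed.

Let off_diagonal := 2^-1 * (sigma x * lam x
  + (1 - lam x ^+ 2) / (1 + lam x ^+ 2) * 'D_(e0 x) lam x).

(** The curvature enters the entries off the diagonal only through
    $R(e_0, e_1)\xi$, which [curv_xi] expresses by $e_0(\lambda)$ and
    $\sigma\lambda$. The two entries, computed by differentiating in different
    directions, agree because $\cos^2\theta\,(1 + \lambda^2) = 1$. *)
Lemma second_fundamental_formE :
  second_fundamental_form g xi eta e0 e1 lam x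
  = mx2 (- mu x * h) off_diagonal off_diagonal ('D_(e1 x) tilt_sin x).
Proof.
have pos : 1 + lam x ^+ 2 != 0.
  by rewrite gt_eqF// ltr_pwDl// sqr_ge0.
have aa : a * a = (1 + lam x ^+ 2)^-1.
  by apply: (mulIf pos); rewrite mulVf// expr2; exact: tilt_cos_sq.
have hE : h = lam x * a by [].
have a3 : a ^+ 3 = a * (1 + lam x ^+ 2)^-1 by rewrite -aa; ring.
apply/matrixP => i j; rewrite mxE [RHS]mxE ntildeE hpart_etilde (etildeE j).
case: (i == 0); case: (j == 0).
- exact: sff00.
- rewrite -[LHS]/(sff (e0 x) _ _) sff01 derive_tilt_sin// derive_tilt_cos//.
  rewrite /off_diagonal /rho /curvature_form -/a hE.
  move: ('D_(e0 x) lam x) => d.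
  transitivity (a * a * d - 2^-1 * ((d - sigma x * lam x)
      * (a * a * (1 + lam x ^+ 2)))); first by ring.
  by rewrite aa; field.
- rewrite -[LHS]/(sff (a *: e1 x) _ _) sff10 /off_diagonal /rho.
  rewrite /curvature_form hE; move: ('D_(e0 x) lam x) => d.
  transitivity (a * a * (lam x * sigma x + 2^-1 * ((d - sigma x * lam x)
      * (1 - lam x ^+ 2)))); first by ring.
  by rewrite aa; field.
rewrite -[LHS]/(sff (a *: e1 x) _ _) sff11.
have DZ f : differentiable f x -> 'D_(a *: e1 x) f x = a * 'D_(e1 x) f x.
  by move=> df; rewrite !deriveE// linearZ.
rewrite !DZ// derive_tilt_sin// derive_tilt_cos// -/a hE a3.
move: ('D_(e1 x) lam x) => d.
transitivity (a * a * (a * d)); first by ring.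
by rewrite aa; field.
Qed.

End AtPoint.
End UnitField.

(** * Passage to a chart *)

Lemma chart_metric_on (R : realType) (n : nat) (M : smooth_manifold R n)
    (g : riemannian_metric M) (i : chart_index M) :
  metric_on (chart i @` dom i) (g i).
Proof.
split; first exact: chart_open.
- exact: rm_smooth.
- by move=> _ [p pi <-]; exact: rm_sym.
- by move=> _ [p pi <-]; exact: rm_pos.
Qed.

Unset Implicit Arguments.

Theorem lemma3p2 (R : realType) (M : smooth_manifold R 2)
    (g : riemannian_metric M) (xi eta e0 e1 : vector_field M)
    (lambda mu sigma : M -> R)
    (xi_eta_orthonormal : orthonormal_pair g xi eta)
    (e0_e1_orthonormal : orthonormal_pair g e0 e1)
    (nabla_e0_xi : forall (i : chart_index M) (p : M), dom i p ->
       nabla g e0 xi i p = 0)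
    (nabla_e1_xi : forall (i : chart_index M) (p : M), dom i p ->
       nabla g e1 xi i p = lambda p *: vf_at eta i p)
    (nabla_e0_e0 : forall (i : chart_index M) (p : M), dom i p ->
       nabla g e0 e0 i p = mu p *: vf_at e1 i p)
    (nabla_e1_e1 : forall (i : chart_index M) (p : M), dom i p ->
       nabla g e1 e1 i p = sigma p *: vf_at e0 i p)
    (i : chart_index M) (p : M) (p_dom : dom i p) :
  let s : nat := if same_orientation xi eta e0 e1 i p then 1%N else 0%N in
  let K := gauss_curv (g i) (chart i p) in
  let Omega := second_fundamental_form (g i) (xi i) (eta i) (e0 i) (e1 i)
                 (fun x => lambda (chart_inv i x)) (chart i p) in
  let lam := lambda p in
  let e0lam := vderive e0 lambda i p in
  let Omega00 := - mu p * (lam / Num.sqrt (1 + lam ^+ 2)) in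
  let Omega11 :=
    vderive e1 (fun q => lambda q / Num.sqrt (1 + lambda q ^+ 2)) i p in
  let Omega01 := (-1) ^+ (s + 1) * (K / 2) + e0lam / (1 + lam ^+ 2) in
  let Omega01' := 2^-1 * (sigma p * lam
                          + (1 - lam ^+ 2) / (1 + lam ^+ 2) * e0lam) in
  Omega = mx2 Omega00 Omega01 Omega01 Omega11 /\
  Omega = mx2 Omega00 Omega01' Omega01' Omega11.
Proof.
move=> s K Omega lam e0lam Omega00 Omega11 Omega01 Omega01'.
pose U : set 'rV[R]_2 := [set chart i q | q in dom i].
have gU : metric_on U (g i) := chart_metric_on g i.
have Ux : U (chart i p) by exists p.
pose pull (f : M -> R) (x : 'rV[R]_2) := f (chart_inv i x).
have pullE f q : dom i q -> pull f (chart i q) = f q.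
  by move=> iq; rewrite /pull chartK.
have C2 (X : vector_field M) : Ck U 2 (X i) by exact: vf_smooth.
have xi_eta y : U y -> orthonormal_at (g i) y (xi i y) (eta i y).
  by case=> q iq <-; exact: xi_eta_orthonormal.
have e0_e1 y : U y -> orthonormal_at (g i) y (e0 i y) (e1 i y).
  by case=> q iq <-; exact: e0_e1_orthonormal.
have d0xi y : U y -> cov (g i) (e0 i y) (xi i) y = 0.
  by case=> q iq <-; exact: nabla_e0_xi.
have d1xi y : U y -> cov (g i) (e1 i y) (xi i) y = pull lambda y *: eta i y.
  by case=> q iq <-; rewrite pullE//; exact: nabla_e1_xi.
have d0e0 y : U y -> cov (g i) (e0 i y) (e0 i) y = pull mu y *: e1 i y.
  by case=> q iq <-; rewrite pullE//; exact: nabla_e0_e0.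
have d1e1 y : U y -> cov (g i) (e1 i y) (e1 i) y = pull sigma y *: e0 i y.
  by case=> q iq <-; rewrite pullE//; exact: nabla_e1_e1.
have := second_fundamental_formE gU (C2 xi) (C2 eta) (C2 e0) (C2 e1)
  xi_eta e0_e1 d0xi d1xi d0e0 d1e1 Ux.
have rho_xi := curv_xi gU (C2 xi) (C2 eta) (C2 e1)
  xi_eta e0_e1 d0xi d1xi d1e1 Ux.
have rho_eta := curv_eta gU (C2 xi) (C2 eta) (C2 e1)
  xi_eta e0_e1 d0xi d1xi d1e1 Ux.
have KE := gauss_curv_frames gU Ux (xi_eta _ Ux) (e0_e1 _ Ux) rho_xi rho_eta.
rewrite /tilt_sin /tilt_cos !pullE// => OmegaE.
(* Up to the orientation sign K is the opposite of e0(lambda) - sigma lambda,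
   which turns the second form of the matrix into the first. *)
have KE' : (-1) ^+ (s + 1) * K = - (e0lam - sigma p * lam).
  by rewrite /lam -(pullE sigma p p_dom) -(pullE lambda p p_dom); exact: KE.
have E01 : Omega01 = Omega01'.
  rewrite /Omega01 /Omega01' mulrA KE'.
  have pos : 1 + lam ^+ 2 != 0 by rewrite gt_eqF// ltr_pwDl// sqr_ge0.
  by move: pos; move: (lam) (e0lam) => l d pos; field.
by rewrite E01; split; exact: OmegaE.
Qed.
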